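(* Let $(\bar M,\bar\nabla,\bar\nabla^{*},\bar g,\phi,\nu)$ be an indefinite Kenmotsu statistical manifold and $M$ a contact $SCR$-lightlike submanifold of $\bar M$. Then $\bar D\perp\{\nu\}$ defines a totally geodesic foliation in $M$ if and only if $$\bar g(h^{*s}(X,\phi Y)+h^{s}(X,\phi Y),\phi Z)=0$$ for all $X,Y\in\Gamma(\bar D\perp\{\nu\})$ and $Z\in\Gamma(D^{\perp})$.
   Context: Indefinite Kenmotsu statistical manifold $(\bar M,\bar\nabla,\bar\nabla^{*},\bar g,\phi,\nu)$: $\bar M$ is a $(2n+1)$-dimensional manifold with a semi-Riemannian metric $\bar g$ of constant index $q\ge1$, a torsion-free affine connection $\bar\nabla$ with $(\bar\nabla_X\bar g)(Y,Z)=(\bar\nabla_Y\bar g)(X,Z)$, dual connection $\bar\nabla^{*}$ defined by $X\bar g(Y,Z)=\bar g(\bar\nabla_XY,Z)+\bar g(Y,\bar\nabla^{*}_XZ)$, Levi-Civita connection $\widehat{\bar\nabla}=\frac12(\bar\nabla+\bar\nabla^{*})$, and $K(X,Y)=\bar\nabla_XY-\widehat{\bar\nabla}_XY$. It carries a $(1,1)$-tensor field $\phi$, a vector field $\nu$ and a $1$-form $\eta$ with $\bar g(\phi X,\phi Y)=\bar g(X,Y)-\eta(X)\eta(Y)$, $\bar g(\nu,\nu)=1$, $\phi^2X=-X+\eta(X)\nu$, $\bar g(X,\nu)=\eta(X)$, $\bar g(\phi X,Y)+\bar g(X,\phi Y)=0$, satisfying $(\widehat{\bar\nabla}_X\phi)Y=\eta(Y)\phi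 X-\bar g(\phi X,Y)\nu$, $\widehat{\bar\nabla}_X\nu=-X+\eta(X)\nu$, and $K(X,\phi Y)=-\phi K(X,Y)$, for all vector fields $X,Y,Z$ on $\bar M$. Lightlike submanifold: a submanifold $M$ of $\bar M$ with degenerate induced metric $g$ such that $Rad(TM)=TM\cap TM^{\perp}$ is a distribution of rank $r\ge1$. $S(TM)$ (screen distribution) is a chosen complement of $Rad(TM)$ in $TM$, $TM=Rad(TM)\perp S(TM)$; $S(TM^{\perp})$ (screen transversal bundle) is a chosen complement of $Rad(TM)$ in $TM^\perp$. The lightlike transversal bundle $ltr(TM)$ is locally spanned by sections $N_i$ of the orthogonal complement of $S(TM^\perp)$ in $S(TM)^\perp$ with $\bar g(\xi_i,N_j)=\delta_{ij}$, $\bar g(N_i,N_j)=0$ for a local basis $\{\xi_i\}$ of $Rad(TM)$. Put $tr(TM)=ltr(TM)\perp S(TM^\perp)$, so $T\bar M|_M=TM\oplus tr(TM)$. Gauss formulae: for $X,Y\in\Gamma(TM)$, $\bar\nabla_XY=\nabla_XY+h^l(X,Y)+h^s(X,Y)$ and $\bar\nabla^{*}_XY=\nabla^{*}_XY+h^{*l}(X,Y)+h^{*s}(X,Y)$, with $\nabla_XY,\nabla^*_XY\in\Gamma(TM)$, $h^l,h^{*l}$ valued in $ltr(TM)$, $h^s,h^{*s}$ valued in $S(TM^\perp)$. Also $\widehat\nabla_XY$ denotes the $TM$-component of $\widehat{\bar\nabla}_XY$. Contact $SCR$-lightlike submanifold: a lightlike submanifold $M$ tangent to $\nu$ such that (1)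 there are real non-empty distributions $D$, $D^\perp$ with $S(TM)=D\perp D^\perp\perp\{\nu\}$, $\phi(D^\perp)\subset S(TM^\perp)$, $D\cap D^\perp=\{0\}$, where $D^\perp$ is the orthogonal complement of $D\perp\{\nu\}$ in $S(TM)$; (2) $D$ and $Rad(TM)$ are invariant under $\phi$ (hence so is $ltr(TM)$). Put $\bar D=D\perp Rad(TM)$, so $TM=\bar D\perp D^\perp\perp\{\nu\}$. A distribution $E$ on $M$ defines a totally geodesic foliation if $\widehat\nabla_XY\in\Gamma(E)$ for all $X,Y\in\Gamma(E)$. *)

(* Defs.v *)
From HB Require Import structures.
From mathcomp Require Import all_boot all_order all_algebra.
From mathcomp Require Import all_classical all_reals all_analysis.

Set Implicit Arguments.
Unset Strict Implicit.
Unset Printing Implicit Defensive.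

Import Order.TTheory GRing.Theory Num.Theory.
Import numFieldNormedType.Exports.

Local Open Scope classical_set_scope.
Local Open Scope ring_scope.

(* To be used on open sets only, where it is the class C^k: F is C^(k+1) iff it
   is differentiable with all its directional derivatives of class C^k. *)
Fixpoint class_C (R : realType) (n : nat) (W : normedModType R) (k : nat)
    (U : set 'rV[R]_n) (F : 'rV[R]_n -> W) : Prop :=
  if k is k'.+1 then
    (forall x, U x -> differentiable F x) /\ (forall v, class_C k' U ('D_v F))
  else forall x, U x -> {for x, continuous F}.

Definition smooth_on (R : realType) (n : nat) (W : normedModType R)
    (U : set 'rV[R]_n) (F : 'rV[R]_n -> W) : Prop :=
  forall k, class_C k U F.

Record chart (R : realType) (n : nat) (T : topologicalType) := Chart {
  dom : set T;
  cmap :> T -> 'rV[R]_n;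
  cinv : 'rV[R]_n -> T;
  dom_open : open dom;
  cod_open : open (cmap @` dom);
  cmapK : forall p, dom p -> cinv (cmap p) = p;
  cmap_continuous : forall p, dom p -> {for p, continuous cmap};
  cinv_continuous : forall x, (cmap @` dom) x -> {for x, continuous cinv}
}.

Record manifold (R : realType) (n : nat) := Manifold {
  carrier :> topologicalType;
  manifold_hausdorff : hausdorff_space carrier;
  manifold_second_countable : @second_countable carrier;
  atlas : set (chart R n carrier);
  atlas_cover : forall p, exists c, atlas c /\ dom c p;
  atlas_compatible : forall c d, atlas c -> atlas d ->
    smooth_on (c @` (dom c `&` dom d)) (d \o cinv c)
}.

(* A preferred chart around p. The tangent space T_p M is 'rV[R]_n, a vector
   being represented by its components in this chart. *)
Definition chart_at (R : realType) (n : nat) (M : manifold R n) (p : M) :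
    chart R n M :=
  projT1 (cid (atlas_cover p)).

(* Components of v in T_p M in another chart c around p. *)
Definition components (R : realType) (n : nat) (M : manifold R n)
    (c : chart R n M) (p : M) (v : 'rV[R]_n) : 'rV[R]_n :=
  'd (c \o cinv (chart_at p)) (chart_at p p) v.

Definition smooth_fun (R : realType) (n : nat) (M : manifold R n)
    (a : M -> R) : Prop :=
  forall c, atlas c -> smooth_on (c @` dom c) (a \o cinv c : 'rV[R]_n -> R^o).

(* (X a)(p) *)
Definition lie (R : realType) (n : nat) (M : manifold R n)
    (X : M -> 'rV[R]_n) (a : M -> R) (p : M) : R :=
  'd (a \o cinv (chart_at p) : 'rV[R]_n -> R^o) (chart_at p p) (X p).

Section MapsBetweenManifolds.
Context (R : realType) (m n : nat) (M : manifold R m) (N : manifold R n).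

Definition smooth_map (f : M -> N) : Prop :=
  continuous f /\
  forall c d, atlas c -> atlas d ->
    smooth_on (c @` (dom c `&` f @^-1` dom d)) (d \o f \o cinv c).

Definition dmap (f : M -> N) (p : M) : 'Hom('rV[R]_m, 'rV[R]_n) :=
  linfun ('d (chart_at (f p) \o f \o cinv (chart_at p)) (chart_at p p)).

(* V p in T_(f p) N for all p: V is a section of the pull-back bundle f^*TN,
   smooth over the open set U. *)
Definition smooth_section_on (U : set M) (f : M -> N) (V : M -> 'rV[R]_n) :=
  forall c d, atlas c -> atlas d ->
    smooth_on (c @` (U `&` dom c `&` f @^-1` dom d))
      (fun x => components d (f (cinv c x)) (V (cinv c x))).

End MapsBetweenManifolds.

Definition smooth_section (R : realType) (m n : nat) (M : manifold R m)
    (N : manifold R n) (f : M -> N) (V : M -> 'rV[R]_n) : Prop :=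
  smooth_section_on setT f V.

(* Vector fields are the sections along the identity. *)
Definition vector_field (R : realType) (m : nat) (M : manifold R m)
    (X : M -> 'rV[R]_m) : Prop :=
  smooth_section (idfun : M -> M) X.

(* D is a connection on f^*TN; D X V stands for D_X V. *)
Definition connection_along (R : realType) (m n : nat) (M : manifold R m)
    (N : manifold R n) (f : M -> N)
    (D : (M -> 'rV[R]_m) -> (M -> 'rV[R]_n) -> M -> 'rV[R]_n) : Prop :=
  [/\ forall X V, vector_field X -> smooth_section f V ->
        smooth_section f (D X V),
      forall a X X' V, smooth_fun a -> vector_field X -> vector_field X' ->
        smooth_section f V ->
        forall p, D (fun q => a q *: X q + X' q) V p
                  = a p *: D X V p + D X' V p,
      forall X V V', vector_field X -> smooth_section f V ->
        smooth_section f V' ->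
        forall p, D X (fun q => V q + V' q) p = D X V p + D X V' p
    & forall a X V, smooth_fun a -> vector_field X -> smooth_section f V ->
        forall p, D X (fun q => a q *: V q) p
                  = lie X a p *: V p + a p *: D X V p].

Definition affine_connection (R : realType) (n : nat) (N : manifold R n)
    (nab : (N -> 'rV[R]_n) -> (N -> 'rV[R]_n) -> N -> 'rV[R]_n) : Prop :=
  connection_along (idfun : N -> N) nab.

(* D is the connection f^*nab, which gives its meaning to nab_X V for X tangent
   to M and V defined only along f: if X' and Y are vector fields on N with
   X' = df(X) at p, then D_X (Y o f) = nab_X' Y at p. This property determines
   D uniquely (every V is locally a combination of some Y o f); for V = df(Y')
   it is the value at p of nab_X' Y for any local extensions X', Y. *)
Definition pullback_connection (R : realType) (m n : nat) (M : manifold R m)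
    (N : manifold R n) (f : M -> N)
    (nab : (N -> 'rV[R]_n) -> (N -> 'rV[R]_n) -> N -> 'rV[R]_n)
    (D : (M -> 'rV[R]_m) -> (M -> 'rV[R]_n) -> M -> 'rV[R]_n) : Prop :=
  connection_along f D /\
  forall X X' Y p, vector_field X -> vector_field X' -> vector_field Y ->
    X' (f p) = dmap f p (X p) -> D X (Y \o f) p = nab X' Y (f p).

(* The bracket [X, Y] is characterised by its action on functions. *)
Definition torsion_free (R : realType) (n : nat) (N : manifold R n)
    (nab : (N -> 'rV[R]_n) -> (N -> 'rV[R]_n) -> N -> 'rV[R]_n) : Prop :=
  forall X Y a, vector_field X -> vector_field Y -> smooth_fun a ->
  forall p, lie (fun q => nab X Y q - nab Y X q) a p
            = lie X (lie Y a) p - lie Y (lie X a) p.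

(* For a pair of dual connections, their mean is the Levi-Civita connection. *)
Definition mean_connection (R : realType) (A B C : Type) (n : nat)
    (D D' : A -> B -> C -> 'rV[R]_n) (X : A) (Y : B) (p : C) : 'rV[R]_n :=
  2^-1 *: (D X Y p + D' X Y p).

Definition bform (R : realType) (n : nat) (G : 'M[R]_n) (u v : 'rV[R]_n) : R :=
  (u *m G *m v^T) 0 0.

(* The orthogonal of U, for a symmetric G. *)
Definition orthv (R : realType) (n : nat) (G : 'M[R]_n)
    (U : {vspace 'rV[R]_n}) : {vspace 'rV[R]_n} :=
  (\bigcap_(u <- vbasis U) lker (linfun (mulmxr (G *m u^T))))%VS.

Lemma orthvP (R : realType) (n : nat) (G : 'M[R]_n) (U : {vspace 'rV[R]_n})
    (v : 'rV[R]_n) :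
  (forall u, u \in U -> bform G v u = 0) <-> v \in orthv G U.
Proof.
have kerE u : (v \in lker (linfun (mulmxr (G *m u^T)))) = (bform G v u == 0).
  rewrite memv_ker lfunE /= /bform -mulmxA.
  apply/eqP/eqP => [->|h]; first by rewrite mxE.
  by apply/rowP => i; rewrite !ord1 h mxE.
have -> : (v \in orthv G U) = all (fun u => bform G v u == 0) (vbasis U).
  rewrite /orthv; elim: (val (vbasis U)) => [|u s IHs] /=.
    by rewrite big_nil memvf.
  by rewrite big_cons memv_cap IHs kerE.
split=> [h|/allP h u uU].
  by apply/allP => u uU; apply/eqP/h/vbasis_mem.
rewrite (coord_vbasis uU) /bform linear_sum mulmx_sumr summxE big1 // => i _.
rewrite linearZ -scalemxAr mxE.
have /h/eqP : (vbasis U)`_i \in (vbasis U : seq _).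
  by rewrite mem_nth // size_tuple.
by rewrite /bform => ->; rewrite mulr0.
Qed.

Definition has_index (R : realType) (n : nat) (G : 'M[R]_n) (q : nat) : Prop :=
  let negative_definite (U : {vspace 'rV[R]_n}) :=
    forall u, u \in U -> u != 0 -> bform G u u < 0 in
  (exists2 U, \dim U = q & negative_definite U) /\
  (forall U, negative_definite U -> (\dim U <= q)%N).

(* g p is the Gram matrix of the metric at p, in the preferred chart at p. *)
Definition semi_riemannian (R : realType) (n : nat) (N : manifold R n)
    (g : N -> 'M[R]_n) (q : nat) : Prop :=
  [/\ forall p, (g p)^T = g p,
      forall p, g p \in unitmx,
      forall p, has_index (g p) q
    & forall X Y, vector_field X -> vector_field Y ->
        smooth_fun (fun p => bform (g p) (X p) (Y p))].

Record kenmotsu_statistical (R : realType) (n : nat)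
    (N : manifold R (2 * n).+1) := KenmotsuStatistical {
  nab : (N -> 'rV[R]_(2 * n).+1) -> (N -> 'rV[R]_(2 * n).+1) ->
        N -> 'rV[R]_(2 * n).+1;
  nabs : (N -> 'rV[R]_(2 * n).+1) -> (N -> 'rV[R]_(2 * n).+1) ->
         N -> 'rV[R]_(2 * n).+1;
  gbar : N -> 'M[R]_((2 * n).+1);
  phi : N -> 'End('rV[R]_(2 * n).+1);
  nu : N -> 'rV[R]_(2 * n).+1;
  eta : N -> 'Hom('rV[R]_(2 * n).+1, R^o);
  metric_index : nat;

  metric_index_gt0 : (1 <= metric_index)%N;
  gbar_semi_riemannian : semi_riemannian gbar metric_index;
  nab_affine : affine_connection nab;
  nab_torsion_free : torsion_free nab;
  (* (nab_X gbar)(Y, Z) = (nab_Y gbar)(X, Z) *)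
  nab_codazzi : forall X Y Z, vector_field X -> vector_field Y ->
    vector_field Z -> forall p,
    lie X (fun q => bform (gbar q) (Y q) (Z q)) p
      - bform (gbar p) (nab X Y p) (Z p) - bform (gbar p) (Y p) (nab X Z p)
    = lie Y (fun q => bform (gbar q) (X q) (Z q)) p
      - bform (gbar p) (nab Y X p) (Z p) - bform (gbar p) (X p) (nab Y Z p);
  nabs_affine : affine_connection nabs;
  nabs_dual : forall X Y Z, vector_field X -> vector_field Y ->
    vector_field Z -> forall p,
    lie X (fun q => bform (gbar q) (Y q) (Z q)) p
    = bform (gbar p) (nab X Y p) (Z p) + bform (gbar p) (Y p) (nabs X Z p);

  phi_smooth : forall X, vector_field X ->
    vector_field (fun p => phi p (X p));
  nu_smooth : vector_field nu;
  eta_smooth : forall X, vector_field X ->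
    smooth_fun (fun p => eta p (X p) : R);
  phi_isometry : forall p u v,
    bform (gbar p) (phi p u) (phi p v) = bform (gbar p) u v - eta p u * eta p v;
  nu_unit : forall p, bform (gbar p) (nu p) (nu p) = 1;
  phi_square : forall p u, phi p (phi p u) = - u + (eta p u : R) *: nu p;
  eta_nu : forall p u, bform (gbar p) u (nu p) = eta p u;
  phi_skew : forall p u v,
    bform (gbar p) (phi p u) v + bform (gbar p) u (phi p v) = 0;

  (* (hat nab_X phi) Y = eta(Y) phi X - gbar(phi X, Y) nu *)
  kenmotsu_phi : forall X Y, vector_field X -> vector_field Y -> forall p,
    mean_connection nab nabs X (fun q => phi q (Y q)) p
      - phi p (mean_connection nab nabs X Y p)
    = (eta p (Y p) : R) *: phi p (X p)
      - bform (gbar p) (phi p (X p)) (Y p) *: nu p;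
  kenmotsu_nu : forall X, vector_field X -> forall p,
    mean_connection nab nabs X nu p = - X p + (eta p (X p) : R) *: nu p;
  (* K(X, phi Y) = - phi K(X, Y), with K = nab - hat nab *)
  kenmotsu_K : forall X Y, vector_field X -> vector_field Y -> forall p,
    nab X (fun q => phi q (Y q)) p
      - mean_connection nab nabs X (fun q => phi q (Y q)) p
    = - phi p (nab X Y p - mean_connection nab nabs X Y p)
}.

(* All bundles over M below are given by subspaces of the tangent spaces
   T_(f p) N of the ambient manifold; T_p M is identified with TM f p. *)
Section Submanifolds.
Context (R : realType) (m n : nat) (M : manifold R m) (N : manifold R n).

Definition submanifold (f : M -> N) : Prop :=
  [/\ smooth_map f, injective f & forall p, injective (dmap f p)].

Definition TM (f : M -> N) (p : M) : {vspace 'rV[R]_n} := limg (dmap f p).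

Definition TMperp (g : N -> 'M[R]_n) (f : M -> N) (p : M) :
    {vspace 'rV[R]_n} :=
  orthv (g (f p)) (TM f p).

Definition Rad (g : N -> 'M[R]_n) (f : M -> N) (p : M) : {vspace 'rV[R]_n} :=
  (TM f p :&: TMperp g f p)%VS.

(* Smooth subbundle of rank k of f^*TN. *)
Definition subbundle (f : M -> N) (k : nat) (E : M -> {vspace 'rV[R]_n}) :=
  forall p, exists (U : set M) (s : 'I_k -> M -> 'rV[R]_n),
    [/\ open U, U p, forall i, smooth_section_on U f (s i)
      & forall q, U q -> basis_of (E q) [tuple s i q | i < k]].

(* Distribution of rank k on M, that is, smooth subbundle of TM. *)
Definition distribution (f : M -> N) (k : nat) (E : M -> {vspace 'rV[R]_n}) :=
  forall p, exists (U : set M) (s : 'I_k -> M -> 'rV[R]_m),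
    [/\ open U, U p, forall i, smooth_section_on U (idfun : M -> M) (s i)
      & forall q, U q -> basis_of (E q) [tuple dmap f q (s i q) | i < k]].

(* X is in Gamma(E), for E contained in TM. *)
Definition section_of (f : M -> N) (E : M -> {vspace 'rV[R]_n})
    (X : M -> 'rV[R]_m) : Prop :=
  vector_field X /\ forall p, dmap f p (X p) \in E p.

End Submanifolds.

(* STM, STMp, ltr are the chosen bundles S(TM), S(TM^perp), ltr(TM); ltr(TM) is
   part of the data since the conditions on its frames do not determine it. *)
Record lightlike_submanifold (R : realType) (m n : nat) (M : manifold R m)
    (N : manifold R n) (g : N -> 'M[R]_n) (f : M -> N) := LightlikeSubmanifold {
  lightlike_submfd : submanifold f;
  rad_rank : nat;
  rad_rank_gt0 : (1 <= rad_rank)%N;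
  rad_distribution : distribution f rad_rank (Rad g f);
  STM : M -> {vspace 'rV[R]_n};
  STM_distribution : exists k, distribution f k STM;
  STM_sum : forall p, (Rad g f p + STM p)%VS = TM f p;
  STM_cap : forall p, (Rad g f p :&: STM p)%VS = 0%VS;
  STMp : M -> {vspace 'rV[R]_n};
  STMp_subbundle : exists k, subbundle f k STMp;
  STMp_sum : forall p, (Rad g f p + STMp p)%VS = TMperp g f p;
  STMp_cap : forall p, (Rad g f p :&: STMp p)%VS = 0%VS;
  ltr : M -> {vspace 'rV[R]_n};
  ltr_frame : forall p, exists (U : set M)
      (xi : 'I_rad_rank -> M -> 'rV[R]_m) (L : 'I_rad_rank -> M -> 'rV[R]_n),
    [/\ open U, U p,
        forall i, smooth_section_on U (idfun : M -> M) (xi i),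
        forall i, smooth_section_on U f (L i)
      & forall q, U q ->
        [/\ basis_of (Rad g f q) [tuple dmap f q (xi i q) | i < rad_rank],
            ltr q = <<[tuple L i q | i < rad_rank]>>%VS,
            forall i, L i q \in
              (orthv (g (f q)) (STM q) :&: orthv (g (f q)) (STMp q))%VS,
            forall i j, bform (g (f q)) (dmap f q (xi i q)) (L j q)
                        = (i == j)%:R
          & forall i j, bform (g (f q)) (L i q) (L j q) = 0]]
}.

(* For w in T_(f p) N, components of w in the decomposition
   f^*TN = TM + ltr(TM) + S(TM^perp). With w = nab_X Y, they are the induced
   connection and the second fundamental form h^s of the Gauss formula. *)
Definition TM_part (R : realType) (m n : nat) (M : manifold R m)
    (N : manifold R n) (g : N -> 'M[R]_n) (f : M -> N)
    (S : lightlike_submanifold g f) (p : M) (w : 'rV[R]_n) : 'rV[R]_n :=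
  daddv_pi (TM f p) (ltr S p + STMp S p)%VS w.

Definition STMp_part (R : realType) (m n : nat) (M : manifold R m)
    (N : manifold R n) (g : N -> 'M[R]_n) (f : M -> N)
    (S : lightlike_submanifold g f) (p : M) (w : 'rV[R]_n) : 'rV[R]_n :=
  daddv_pi (STMp S p) (TM f p + ltr S p)%VS w.

(* h^s(X, V), where D is the pull-back along f of an affine connection, X a
   vector field on M and V a section of TM seen in f^*TN. *)
Definition hs (R : realType) (m n : nat) (M : manifold R m)
    (N : manifold R n) (g : N -> 'M[R]_n) (f : M -> N)
    (S : lightlike_submanifold g f)
    (D : (M -> 'rV[R]_m) -> (M -> 'rV[R]_n) -> M -> 'rV[R]_n)
    (X : M -> 'rV[R]_m) (V : M -> 'rV[R]_n) (p : M) : 'rV[R]_n :=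
  STMp_part S p (D X V p).

(* Smoothness of hat nabla_X Y is automatic, so that being in Gamma(E) means
   taking its values in E. *)
Definition totally_geodesic_foliation (R : realType) (m n : nat)
    (M : manifold R m) (N : manifold R n) (g : N -> 'M[R]_n) (f : M -> N)
    (S : lightlike_submanifold g f)
    (D D' : (M -> 'rV[R]_m) -> (M -> 'rV[R]_n) -> M -> 'rV[R]_n)
    (E : M -> {vspace 'rV[R]_n}) : Prop :=
  forall X Y, section_of f E X -> section_of f E Y -> forall p,
    TM_part S p (mean_connection D D' X (fun q => dmap f q (Y q)) p) \in E p.

(* Dinv, Dperp are the distributions D, D^perp; "non-empty" means of positive
   rank. *)
Record contact_SCR (R : realType) (n m : nat) (N : manifold R (2 * n).+1)
    (K : kenmotsu_statistical N) (M : manifold R m) (f : M -> N) := ContactSCR {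
  SCR_lightlike :> lightlike_submanifold (gbar K) f;
  nu_tangent : forall p, nu K (f p) \in TM f p;
  Dinv : M -> {vspace 'rV[R]_(2 * n).+1};
  Dperp : M -> {vspace 'rV[R]_(2 * n).+1};
  Dinv_distribution : exists2 k, (1 <= k)%N & distribution f k Dinv;
  Dperp_distribution : exists2 k, (1 <= k)%N & distribution f k Dperp;
  STM_decomposition : forall p,
    STM SCR_lightlike p = (Dinv p + Dperp p + <[nu K (f p)]>)%VS;
  Dinv_nu_orthogonal : forall p,
    (Dinv p <= orthv (gbar K (f p)) <[nu K (f p)]>)%VS;
  Dperp_orthogonal : forall p,
    Dperp p = (STM SCR_lightlike p
               :&: orthv (gbar K (f p)) (Dinv p + <[nu K (f p)]>))%VS;
  Dinv_Dperp_cap : forall p, (Dinv p :&: Dperp p)%VS = 0%VS;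
  phi_Dperp : forall p, (phi K (f p) @: Dperp p <= STMp SCR_lightlike p)%VS;
  phi_Dinv : forall p, (phi K (f p) @: Dinv p <= Dinv p)%VS;
  phi_Rad : forall p, (phi K (f p) @: Rad (gbar K) f p <= Rad (gbar K) f p)%VS
}.

Definition Dbar (R : realType) (n m : nat) (N : manifold R (2 * n).+1)
    (K : kenmotsu_statistical N) (M : manifold R m) (f : M -> N)
    (S : contact_SCR K f) (p : M) : {vspace 'rV[R]_(2 * n).+1} :=
  (Dinv S p + Rad (gbar K) f p)%VS.

Definition Dbar_nu (R : realType) (n m : nat) (N : manifold R (2 * n).+1)
    (K : kenmotsu_statistical N) (M : manifold R m) (f : M -> N)
    (S : contact_SCR K f) (p : M) : {vspace 'rV[R]_(2 * n).+1} :=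
  (Dbar S p + <[nu K (f p)]>)%VS.

(* Main.v *)
From HB Require Import structures.
From mathcomp Require Import all_boot all_order all_algebra.
From mathcomp Require Import all_classical all_reals all_analysis.
From mathcomp Require Import ring.
Require Import Defs.

Set Implicit Arguments.
Unset Strict Implicit.
Unset Printing Implicit Defensive.

Import Order.TTheory GRing.Theory Num.Theory.
Import numFieldNormedType.Exports.

Local Open Scope classical_set_scope.
Local Open Scope ring_scope.

(** Write W for the Levi-Civita derivative of Y in the direction X, for X and Y
    sections of Dbar + nu, and let Z be a section of Dperp. Since phi Z lies in
    S(TM^perp), which is orthogonal to TM and to ltr(TM), pairing with phi Z
    picks the S(TM^perp) components, and the sum of the two second fundamental
    forms pairs with phi Z to twice g(nabla_X (phi Y), phi Z), where nabla is
    the mean, that is Levi-Civita, connection. The Kenmotsu identity for the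
    derivative of phi turns nabla_X (phi Y) into phi W plus multiples of phi X
    and nu; as eta(Z) = 0, phi preserves the pairing with Z, and X and nu are
    orthogonal to Dperp and to phi Z respectively, what remains is 2 g(W, Z).
    Finally ltr(TM) is orthogonal to S(TM), and S(TM^perp) to TM, so that g(W, Z)
    is the pairing of Z with the tangential component of W. This component belongs to Dbar + nu
    exactly when it is orthogonal to Dperp (mem_Dbar_nu), whence the theorem.

    Two points need more than this computation. First, Y is a vector field on M
    only, whereas the Kenmotsu identity speaks of vector fields on the ambient
    manifold. It is transported to sections along f (kenmotsu_phi_along) by the
    observation that its defect is linear over the smooth functions of M and
    vanishes on restrictions of ambient fields, and that such restrictions
    generate all sections locally (local_frame, tensorial_eq0). Secondly, the
    orthogonality hypothesis concerns global sections of Dperp, so each vector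
    of Dperp must be extended to one (distribution_section). Both rest on
    smooth bump functions (bump_exists), hence on the calculus of class_C
    functions developed at the beginning. *)

(** * Calculus of functions of class C^k *)

Lemma near_open (T : topologicalType) (U : set T) (P : T -> Prop) x :
  open U -> U x -> (forall y, U y -> P y) -> \near x, P x.
Proof. by move=> oU Ux UP; apply: filterS (open_nbhs_nbhs (conj oU Ux)). Qed.

Lemma differentiable_near_eq (R : numFieldType) (V W : normedModType R) (F G : V -> W) x :
  (\near x, F x = G x) -> differentiable F x -> differentiable G x.
Proof.
move=> FG dF; have FGx : F x = G x := nbhs_singleton FG.
have FG0 : \forall h \near (0 : V), F (h + x) = G (h + x).
  by move: FG; rewrite (near_shift 0); apply: filterS => h /=; rewrite subr0.
have GE : G \o shift x = cst (G x) + 'd F x +o_ (0 : V) id.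
  apply/eqaddoP => e e0; have /eqaddoP/(_ e e0) := diff_locally dF.
  apply: filter_app; apply: filterS FG0 => h Fh.
  by rewrite /GRing.add /GRing.opp /= /GRing.add /= -Fh -FGx.
have dGE : 'd G x = 'd F x :> (V -> W).
  by apply: diff_unique GE; exact: diff_continuous.
by apply/diff_locallyP; rewrite dGE; split; [exact: diff_continuous|].
Qed.

Section Calculus.
Context (R : realType) (n : nat).
Implicit Types (U V : set 'rV[R]_n) (a b : 'rV[R]_n -> R^o).

Lemma class_C_sub (W : normedModType R) k U V (F : 'rV[R]_n -> W) :
  V `<=` U -> class_C k U F -> class_C k V F.
Proof.
elim: k F => [|k IHk] F VU /=; first by move=> FU x /VU /FU.
by move=> [dF DF]; split=> [x /VU /dF//|v]; apply: IHk.
Qed.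

Lemma class_C_eq (W : normedModType R) k U (F G : 'rV[R]_n -> W) :
  open U -> (forall x, U x -> F x = G x) -> class_C k U F -> class_C k U G.
Proof.
move=> oU; elim: k F G => [|k IHk] F G FG /=.
  move=> FU x Ux; have Fx := FU x Ux; rewrite /prop_for /continuous_at -FG//.
  have nFG : \near x, F x = G x := near_open oU Ux FG.
  by apply: cvg_trans Fx; exact: (@near_eq_cvg _ _ (nbhs x) _ F G nFG).
move=> [dF DF]; have nearFG x : U x -> \near x, F x = G x.
  by move=> Ux; exact: near_open oU Ux FG.
split=> [x Ux|v].
  exact: differentiable_near_eq (nearFG x Ux) (dF x Ux).
apply: IHk (DF v) => x Ux; apply: near_eq_derive; exact: nearFG.
Qed.

Lemma class_C_local (W : normedModType R) k U (F : 'rV[R]_n -> W) :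
  (forall x, U x -> exists V, V x /\ class_C k V F) -> class_C k U F.
Proof.
elim: k F => [|k IHk] F locF /=.
  by move=> x Ux; have [V [Vx cF]] := locF x Ux; exact: cF.
split=> [x /locF [V [Vx [dF _]]]|v]; first exact: dF.
by apply: IHk => x /locF [V [Vx [_ DF]]]; exists V; split=> //; exact: DF.
Qed.

Lemma class_CS (W : normedModType R) k U (F : 'rV[R]_n -> W) :
  class_C k.+1 U F -> class_C k U F.
Proof.
elim: k F => [|k IHk] F [dF DF] /=; first by move=> x /dF /differentiable_continuous.
by split=> // v; apply: IHk.
Qed.

Lemma class_C_cst (W : normedModType R) k U (w : W) : class_C k U (cst w).
Proof.
elim: k w => [|k IHk] w /=; first by move=> x _; exact: cst_continuous.
split=> [x _|v]; first exact: differentiable_cst.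
rewrite (_ : 'D_v _ = cst 0); first exact: IHk.
by apply/funext => x; rewrite derive_cst.
Qed.

Lemma class_CD (W : normedModType R) k U (F G : 'rV[R]_n -> W) : open U ->
  class_C k U F -> class_C k U G -> class_C k U (fun x => F x + G x).
Proof.
move=> oU; elim: k F G => [|k IHk] F G /=.
  by move=> FU GU x Ux; exact: continuousD (FU x Ux) (GU x Ux).
move=> [dF DF] [dG DG]; split=> [x Ux|v].
  exact: differentiableD (dF x Ux) (dG x Ux).
apply: class_C_eq (IHk _ _ (DF v) (DG v)) => // x Ux.
by rewrite [RHS]deriveD//; apply: diff_derivable; [exact: dF|exact: dG].
Qed.

Lemma class_C_sum (W : normedModType R) k U (I : Type) (r : seq I)
    (F : I -> 'rV[R]_n -> W) : open U ->
  (forall i, class_C k U (F i)) -> class_C k U (fun x => \sum_(i <- r) F i x).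
Proof.
move=> oU FU; elim: r => [|i r IHr].
  by apply: class_C_eq (class_C_cst k U (0 : W)) => // x _; rewrite big_nil.
by apply: class_C_eq (class_CD oU (FU i) IHr) => // x _; rewrite big_cons.
Qed.

Lemma class_CM k U a b : open U ->
  class_C k U a -> class_C k U b -> class_C k U (fun x => a x * b x : R^o).
Proof.
move=> oU; elim: k a b => [|k IHk] a b.
  by move=> aU bU x Ux; exact: continuousM (aU x Ux) (bU x Ux).
move=> ca cb; have [/= da Da] := ca; have [/= db Db] := cb.
split=> [x Ux|v].
  exact: differentiableM (da x Ux) (db x Ux).
have cab := IHk _ _ (class_CS ca) (Db v); have cba := IHk _ _ (class_CS cb) (Da v).
apply: class_C_eq (class_CD oU cab cba) => // x Ux.
by rewrite [RHS]deriveM//; apply: diff_derivable; [exact: da|exact: db].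
Qed.

(** The derivative of 1/a is - (1/a) (1/a) D_v a, of the class that the
    induction provides. *)
Lemma class_CV k U a : open U -> (forall x, U x -> a x != 0) ->
  class_C k U a -> class_C k U (fun x => (a x)^-1 : R^o).
Proof.
move=> oU a0; elim: k => [|k IHk].
  by move=> aU x Ux; exact: continuousV (a0 x Ux) (aU x Ux).
move=> ca; have [/= da Da] := ca.
have /IHk cV := class_CS ca.
split=> [x Ux|v].
  by apply: differentiableV; [exact: da|exact: a0].
have cV2 := class_CM oU (class_CM oU (class_C_cst k U (-1 : R^o)) cV) cV.
apply: class_C_eq (class_CM oU cV2 (Da v)) => // x Ux /=.
rewrite [RHS](@deriveV _ _ a) ?a0 //; last by apply: diff_derivable; exact: da.
by rewrite expr2 invfM mulN1r !mulNr /GRing.scale /= mulNr.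
Qed.

End Calculus.

Section Coordinates.
Context (R : realType) (n : nat).
Implicit Types (U : set 'rV[R]_n).

(** Products and compositions are thereby studied for scalar functions only. *)
Lemma class_C_rV k U m (F : 'rV[R]_n -> 'rV[R]_m) : open U ->
  class_C k U F <-> (forall i, class_C k U (fun x => F x 0 i : R^o)).
Proof.
have derE (G : 'rV[R]_n -> 'rV[R]_m) v x i : differentiable G x ->
    'D_v G x 0 i = 'D_v (fun x => G x 0 i : R^o) x.
  by move=> dG; rewrite derive_mx ?mxE//; apply: diff_derivable.
have sumE (G : 'rV[R]_n -> 'rV[R]_m) x : G x = \sum_i G x 0 i *: 'e_i.
  exact: row_sum_delta.
move=> oU; elim: k F => [|k IHk] F /=.
  split=> [cF i x Ux|cF].
    exact: (@continuous_comp _ _ _ F (fun N : 'rV[R]_m => N 0 i) x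
      (cF x Ux) (@coord_continuous _ _ _ _ _ _)).
  apply: (@class_C_eq _ _ _ 0 U (fun x => \sum_i F x 0 i *: 'e_i)) => //.
  apply: class_C_sum => // i x Ux.
  exact: continuousZ (cF i x Ux) (@cst_continuous _ _ _ _).
split=> [[dF DF] i|cF].
  split=> [x Ux|v].
    apply: (@differentiable_comp _ _ _ _ F (fun N : 'rV[R]_m => N 0 i : R^o)).
      exact: dF.
    exact: differentiable_coord.
  have /IHk /(_ i) := DF v; apply: class_C_eq => // x Ux.
  by apply: derE; exact: dF.
have dF x : U x -> differentiable F x.
  move=> Ux.
  rewrite (_ : F = \sum_(i < m) (fun x => F x 0 i *: 'e_i)).
    by apply: differentiable_sum => i; apply: differentiableZl; exact: (cF i).1.
  by apply/funext => y; rewrite fct_sumE; exact: sumE.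
split=> // v; apply/IHk => i.
have [_ /(_ v)] := cF i; apply: class_C_eq => // x Ux.
by rewrite derE//; exact: dF.
Qed.

End Coordinates.

(** Induction on k through the chain rule
    D_v (G o F) = sum_i (D_v F)_i ((D_(e_i) G) o F). *)
Lemma class_C_comp (R : realType) (n m : nat) k U V (F : 'rV[R]_n -> 'rV[R]_m)
    (G : 'rV[R]_m -> R^o) : open U ->
  (forall x, U x -> V (F x)) -> class_C k U F -> class_C k V G ->
  class_C k U (G \o F).
Proof.
move=> oU UV; elim: k G => [|k IHk] G.
  by move=> cF cG x Ux; apply: continuous_comp; [exact: cF|exact: cG (UV _ Ux)].
move=> cF cG; have [/= dF DF] := cF; have [/= dG DG] := cG.
split=> [x Ux|v].
  by apply: differentiable_comp; [exact: dF|exact: dG (UV _ Ux)].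
have cDF i : class_C k U (fun x => 'D_v F x 0 i : R^o).
  exact: (class_C_rV k _ oU).1 (DF v) i.
have cDG (i : 'I_m) : class_C k U ('D_('e_i) G \o F).
  exact: IHk (class_CS cF) (DG _).
have cD := class_C_sum (index_enum _) oU (fun i => class_CM oU (cDF i) (cDG i)).
apply: class_C_eq cD => // x Ux.
have dFx := dF x Ux; have dGx := dG _ (UV x Ux).
rewrite [RHS]deriveE; last exact: differentiable_comp.
rewrite diff_comp//= -(deriveE v dFx) [in RHS](row_sum_delta ('D_v F x)) linear_sum.
by apply: eq_bigr => i _; rewrite linearZ /= -(deriveE _ dGx).
Qed.

(** * Bump functions on the coordinate space *)

Section FlatFunction.
Context (R : realType).

(** The functions t^-k exp(-1/t), extended by 0: this family is stable under
    derivation up to linear combinations, so that all its members are smooth. *)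
Definition flat (k : nat) (t : R) : R :=
  if 0 < t then t^-1 ^+ k * expR (- t^-1) else 0.

(** The bound comes from exp x >= x^(k+1) / (k+1)! at x = 1/t; it gives the
    differentiability at 0. *)
Lemma flat_le k t : 0 <= flat k t <= k.+1`!%:R * Num.max 0 t.
Proof.
rewrite /flat; case: ltP => t0; last by rewrite lexx mulr0 lexx.
have ti0 : 0 < t^-1 by rewrite invr_gt0.
rewrite mulr_ge0 ?expR_ge0 ?exprn_ge0 ?(ltW ti0)//=.
have tE : t^-1 ^+ k = t * t^-1 ^+ k.+1 by rewrite exprS mulrA mulfV ?gt_eqF// mul1r.
rewrite tE expRN ler_pdivrMr ?expR_gt0// mulrAC [leLHS]mulrC ler_pM2r//.
have /(le_trans _) : 1 + t^-1 ^+ k.+1 / k.+1`!%:R <= expR t^-1.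
  exact: expR_ge1Dxn (ltW ti0).
move=> /(_ (t^-1 ^+ k.+1 / k.+1`!%:R)); rewrite lerDr ler01 => /(_ isT).
by rewrite ler_pdivrMr ?ltr0n ?fact_gt0// mulrC.
Qed.

Lemma is_derive_flat k (t : R) :
  is_derive t 1 (flat k) (flat k.+2 t - k%:R * flat k.+1 t).
Proof.
have [t0|t0|->] := ltgtP t 0.
- apply: (@near_eq_is_derive _ _ _ (cst 0)); last first.
    by apply: is_derive_eq; rewrite /flat !ltNge (ltW t0)/= mulr0 subr0.
  apply: filterS (open_nbhs_nbhs (conj (@open_lt _ 0) t0)).
  by move=> s /= s0; rewrite /flat ltNge (ltW s0).
- have t0N : t != 0 by rewrite gt_eqF.
  apply: (@near_eq_is_derive R R R (fun s : R => s^-1 ^+ k * expR (- s^-1))); last first.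
    have dV : is_derive t 1 (fun s : R => s^-1) (- t^-1 ^+ 2).
      by have := @is_deriveV _ id t 1 1 t0N (is_derive_id _ _) => dV;
        apply: is_derive_eq dV _; rewrite /GRing.scale /= mulr1 exprVn.
    have dE : is_derive t 1 (fun s : R => expR (- s^-1)) (expR (- t^-1) * t^-1 ^+ 2).
      have dN := is_deriveN dV.
      have := @is_derive1_comp _ expR (fun s : R => - s^-1) t _ _ (is_derive_expR _) dN.
      by move=> dC; apply: is_derive_eq dC _; rewrite opprK.
    have dX := is_deriveX k dV.
    have dM := is_deriveM dX dE.
    have -> : (fun s : R => s^-1 ^+ k * expR (- s^-1)) =
        (fun s : R => s^-1) ^+ k * (fun s : R => expR (- s^-1)).
      by rewrite exprfctE.
    apply: is_derive_eq dM _.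
    rewrite /flat t0 /GRing.scale /= exprfctE.
    case: (k) => [|k'] /=; first by rewrite expr0; ring.
    by rewrite !exprS; ring.
  apply: filterS (open_nbhs_nbhs (conj (@open_gt _ 0) t0)).
  by move=> s /= s0; rewrite /flat s0.
(* At 0 the difference quotient for h > 0 is flat k.+1 h, which flat_le bounds by
   a multiple of h. *)
- have cv : h^-1 *: (flat k (h *: 1 + 0) - flat k 0) @[h --> (0:R)^'] --> (0 : R).
    have bnd h : `|h^-1 *: (flat k (h *: 1 + 0) - flat k 0)| <= k.+2`!%:R * `|h|.
      rewrite addr0 [h *: 1]mulr1 {2}/flat ltxx subr0 /GRing.scale /=.
      case: (ltP 0 h) => h0; last by rewrite /flat ltNge h0 /= mulr0 normr0 mulr_ge0.
      have -> : h^-1 * flat k h = flat k.+1 h by rewrite /flat h0 exprS mulrA.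
      have /andP[f0 f1] := flat_le k.+1 h.
      rewrite ger0_norm// (le_trans f1)// ler_wpM2l//.
      by rewrite ge_max normr_ge0 ler_norm.
    apply/cvgr0Pnorm_le => e e0.
    near=> h; apply: le_trans (bnd h) _.
    rewrite mulrC -ler_pdivlMr ?ltr0n ?fact_gt0//.
    near: h; apply: dnbhs0_le.
    by rewrite divr_gt0// ltr0n fact_gt0.
  rewrite {2 3}/flat ltxx mulr0 subr0.
  apply: DeriveDef; first by apply/cvg_ex; exists 0.
  exact: cvg_lim.
Unshelve. all: by end_near. Qed.

(** Induction on the class, for all k at once: the derivative in the direction
    v is D_v rho times a combination of flat k.+2 and flat k.+1 at rho. *)
Lemma class_C_flat n k j (U : set 'rV[R]_n) (rho : 'rV[R]_n -> R^o) : open U ->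
  smooth_on U rho -> class_C j U (flat k \o rho : 'rV[R]_n -> R^o).
Proof.
move=> oU srho.
have drho := (srho 1%N).1.
have dcomp i x : U x -> differentiable (flat i \o rho : 'rV[R]_n -> R^o) x.
  move=> Ux; apply: differentiable_comp; first exact: drho.
  by apply/derivable1_diffP; have [] := is_derive_flat i (rho x).
elim: j k => [|j IHj] k.
  by move=> x Ux; apply: differentiable_continuous; exact: dcomp.
split=> [|v]; first exact: dcomp.
have [_ /(_ v) Drho] := srho j.+1.
have c1 := class_CM oU (class_C_cst _ _ (- k%:R : R^o)) (IHj k.+1).
apply: class_C_eq (class_CM oU Drho (class_CD oU (IHj k.+2) c1)) => // x Ux /=.
have [df dE] := is_derive_flat k (rho x).
have dfl : differentiable (flat k : R -> R^o) (rho x) by exact/derivable1_diffP.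
rewrite [RHS](deriveE _ (dcomp k x Ux)) (diff_comp (drho x Ux) dfl) /=.
rewrite -(deriveE _ (drho x Ux)).
rewrite (deriv1E df).
by rewrite derive1E dE mulNr.
Qed.
End FlatFunction.

Lemma class_C_coord (R : realType) n k (U : set 'rV[R]_n) i : open U ->
  class_C k U (fun x => x 0 i : R^o).
Proof.
move=> oU; suff cid : class_C k U (id : 'rV[R]_n -> 'rV[R]_n).
  exact: (class_C_rV k _ oU).1 cid i.
case: k => [|k]; first by move=> x Ux; exact: cvg_id.
split=> [x _|v]; first exact: ex_diff.
apply: class_C_eq (class_C_cst k U v) => // x _.
by rewrite derive_id.
Qed.

(** The function flat 0 (e^2 - |x - y|^2) for the Euclidean norm, whose square
    is a polynomial and which dominates the supremum norm. *)
Lemma bump_rV (R : realType) n (y : 'rV[R]_n) (e : R) : 0 < e ->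
  exists b : 'rV[R]_n -> R^o, [/\ smooth_on setT b, b y != 0 &
    forall x, b x != 0 -> `|x - y| <= e].
Proof.
move=> e0.
pose rho (x : 'rV[R]_n) : R^o := e ^+ 2 - \sum_i (x 0 i - y 0 i) ^+ 2.
exists (flat 0 \o rho); split.
- move=> k; apply: class_C_flat => [|{}k]; first exact: openT.
  have cc i : class_C k setT (fun x : 'rV[R]_n => x 0 i - y 0 i : R^o).
    apply: class_CD (class_C_cst _ _ _); first exact: openT.
    by apply: class_C_coord; exact: openT.
  have cN := class_C_cst k [set: 'rV[R]_n] (-1 : R^o).
  have cS := class_C_sum (index_enum 'I_n) openT
    (fun i => class_CM openT (cc i) (cc i)).
  have cR := class_CD openT (class_C_cst k setT (e ^+ 2 : R^o))
    (class_CM openT cN cS).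
  apply: (class_C_eq openT _ cR) => x _.
  by rewrite /= mulN1r.
- rewrite /= /rho big1 => [|i _]; last by rewrite subrr expr0n.
  by rewrite subr0 /flat exprn_gt0// expr0 mul1r gt_eqF// expR_gt0.
- move=> x; rewrite /= /flat; case: ifPn => [|_]; last by rewrite eqxx.
  rewrite subr_gt0 => lte _.
  rewrite [leLHS]/Num.Def.normr/= mx_normrE (bigmax_le _ (ltW e0))//= => -[i j] _ /=.
  rewrite !mxE ord1 -ler_sqr ?nnegrE ?(ltW e0)// real_normK ?num_real//.
  apply: le_trans (ltW lte); rewrite (bigD1 j)//= lerDl sumr_ge0// => l _.
  exact: sqr_ge0.
Qed.

(** * Smooth functions on open sets of the coordinate space *)

Section SmoothOn.
Context (R : realType) (n : nat).
Implicit Types (U V : set 'rV[R]_n) (a b : 'rV[R]_n -> R^o).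

Lemma smooth_on_eq (W : normedModType R) U (F G : 'rV[R]_n -> W) :
  open U -> (forall x, U x -> F x = G x) -> smooth_on U F -> smooth_on U G.
Proof. by move=> oU FG sF k; exact: class_C_eq (sF k). Qed.

Lemma smooth_on_local (W : normedModType R) U (F : 'rV[R]_n -> W) :
  (forall x, U x -> exists V, V x /\ smooth_on V F) -> smooth_on U F.
Proof.
move=> locF k; apply: class_C_local => x /locF [V [Vx sF]].
by exists V; split=> //; exact: sF.
Qed.

Lemma smooth_on_sub (W : normedModType R) U V (F : 'rV[R]_n -> W) :
  V `<=` U -> smooth_on U F -> smooth_on V F.
Proof. by move=> VU sF k; exact: class_C_sub (sF k). Qed.

Lemma smooth_on_cst (W : normedModType R) U (w : W) : smooth_on U (cst w).
Proof. by move=> k; exact: class_C_cst. Qed.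

Lemma smooth_onM U a b : open U -> smooth_on U a -> smooth_on U b ->
  smooth_on U (fun x => a x * b x : R^o).
Proof. by move=> oU sa sb k; exact: class_CM. Qed.

Lemma smooth_onV U a : open U -> (forall x, U x -> a x != 0) ->
  smooth_on U a -> smooth_on U (fun x => (a x)^-1 : R^o).
Proof. by move=> oU a0 sa k; exact: class_CV. Qed.

Lemma smooth_onD (W : normedModType R) U (F G : 'rV[R]_n -> W) : open U ->
  smooth_on U F -> smooth_on U G -> smooth_on U (fun x => F x + G x).
Proof. by move=> oU sF sG k; exact: class_CD. Qed.

Lemma smooth_on_sum (W : normedModType R) U (I : Type) (r : seq I)
    (F : I -> 'rV[R]_n -> W) : open U ->
  (forall i, smooth_on U (F i)) -> smooth_on U (fun x => \sum_(i <- r) F i x).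
Proof. by move=> oU sF k; apply: class_C_sum => // i; exact: sF. Qed.

Lemma smooth_on_rV U m (F : 'rV[R]_n -> 'rV[R]_m) : open U ->
  smooth_on U F <-> (forall i, smooth_on U (fun x => F x 0 i : R^o)).
Proof.
move=> oU; split=> [sF i k|sF k]; first exact: (class_C_rV k F oU).1.
by apply/class_C_rV => // i; exact: sF.
Qed.

Lemma smooth_onZ U a m (F : 'rV[R]_n -> 'rV[R]_m) : open U ->
  smooth_on U a -> smooth_on U F -> smooth_on U (fun x => a x *: F x).
Proof.
move=> oU sa /(smooth_on_rV _ oU) sF; apply/smooth_on_rV => // i.
by apply: smooth_on_eq (smooth_onM oU sa (sF i)) => // x _; rewrite mxE.
Qed.

Lemma smooth_on_derive (W : normedModType R) U (F : 'rV[R]_n -> W) v :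
  smooth_on U F -> smooth_on U ('D_v F).
Proof. by move=> sF k; exact: (sF k.+1).2. Qed.

Lemma smooth_on_differentiable (W : normedModType R) U (F : 'rV[R]_n -> W) x :
  smooth_on U F -> U x -> differentiable F x.
Proof. by move=> sF; exact: (sF 1%N).1. Qed.

Lemma smooth_on_comp U m (V : set 'rV[R]_m) (F : 'rV[R]_n -> 'rV[R]_m)
    (G : 'rV[R]_m -> R^o) : open U -> (forall x, U x -> V (F x)) ->
  smooth_on U F -> smooth_on V G -> smooth_on U (G \o F).
Proof. by move=> oU UV sF sG k; exact: class_C_comp oU UV (sF k) (sG k). Qed.

End SmoothOn.

Lemma smooth_on_comp_rV (R : realType) n m l
    (U : set 'rV[R]_n) (V : set 'rV[R]_m)
    (F : 'rV[R]_n -> 'rV[R]_m) (G : 'rV[R]_m -> 'rV[R]_l) :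
  open U -> open V -> (forall x, U x -> V (F x)) ->
  smooth_on U F -> smooth_on V G -> smooth_on U (G \o F).
Proof.
move=> oU oV UV sF /(smooth_on_rV _ oV) sG; apply/smooth_on_rV => // i.
exact: smooth_on_comp oU UV sF (sG i).
Qed.

Lemma near_eq_diff (R : realType) (V W : normedModType R) (F G : V -> W) x v :
  differentiable F x -> (\forall y \near x, F y = G y) -> 'd F x v = 'd G x v.
Proof.
move=> dF FG; have dG := differentiable_near_eq FG dF.
by rewrite -(deriveE v dF) -(deriveE v dG); exact: near_eq_derive.
Qed.

(** Naming the intermediate point y allows it to be written d p instead of
    d (cinv c (c p)) for charts c and d. *)
Lemma diff_compE (R : realType) (U V W : normedModType R) (F : U -> V) (G : V -> W) x y v :
  F x = y -> differentiable F x -> differentiable G y ->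
  'd (G \o F) x v = 'd G y ('d F x v).
Proof. by move=> <- dF dG; rewrite (diff_comp dF dG). Qed.

Lemma diff_idE (R : realType) (V : normedModType R) (x v : V) :
  'd (id : V -> V) x v = v.
Proof. by rewrite (diff_val (df := id)). Qed.

(** * Charts and coordinate changes *)

Section Charts.
Context (R : realType) (n : nat) (M : manifold R n).
Implicit Types (c d e : chart R n M) (p q : M).

Lemma chart_at_atlas p : atlas (chart_at p).
Proof. by rewrite /chart_at; case: cid => c /= []. Qed.

Lemma dom_chart_at p : dom (chart_at p) p.
Proof. by rewrite /chart_at; case: cid => c /= []. Qed.

Lemma chart_image c (A : set M) x : A `<=` dom c ->
  (c @` A) x -> [/\ A (cinv c x), dom c (cinv c x) & c (cinv c x) = x].
Proof.
by move=> Ac [p Ap <-]; rewrite cmapK; [split=> //; exact: Ac|exact: Ac].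
Qed.

Lemma open_chart_image c (A : set M) : open A -> A `<=` dom c -> open (c @` A).
Proof.
move=> oA Ac; rewrite openE => _ [p Ap <-].
have cp : (c @` dom c) (c p) by exists p => //; exact: Ac.
have cA : \forall y \near c p, A (cinv c y).
  apply: (cinv_continuous cp); rewrite cmapK; last exact: Ac.
  exact: open_nbhs_nbhs (conj oA Ap).
have cD : nbhs (c p) (c @` dom c).
  by apply: open_nbhs_nbhs; split=> //; exact: cod_open.
apply: filterS2 cA cD => y Ay /(chart_image (fun _ => id)) [_ _ <-].
by exists (cinv c y).
Qed.

(** The Jacobian at p of the change of coordinates from c to d. *)
Definition transition c d p (v : 'rV[R]_n) : 'rV[R]_n := 'd (d \o cinv c) (c p) v.

Lemma open_domI c d : open (dom c `&` dom d).
Proof. by apply: openI; exact: dom_open. Qed.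

Lemma open_overlap c d : open (c @` (dom c `&` dom d)).
Proof. by apply: open_chart_image; [exact: open_domI|move=> p []]. Qed.

Lemma transition_differentiable c d p : atlas c -> atlas d -> dom c p -> dom d p ->
  differentiable (d \o cinv c) (c p).
Proof.
move=> ac ad cp dp; apply: smooth_on_differentiable (atlas_compatible ac ad) _.
by exists p.
Qed.

Lemma transition_comp c d e p v : atlas c -> atlas d -> atlas e ->
  dom c p -> dom d p -> dom e p ->
  transition d e p (transition c d p v) = transition c e p v.
Proof.
move=> ac ad ae cp dp ep; rewrite /transition.
have cpE : (d \o cinv c) (c p) = d p by rewrite /= cmapK.
have d1 := transition_differentiable ac ad cp dp.
have d2 := transition_differentiable ad ae dp ep.
have d3 : differentiable ((e \o cinv d) \o (d \o cinv c)) (c p).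
  apply: differentiable_comp; first exact: d1.
  by rewrite [X in differentiable _ X]cpE; exact: d2.
have oc : (c @` (dom c `&` dom d)) (c p) by exists p.
have dE : \forall y \near c p, ((e \o cinv d) \o (d \o cinv c)) y = (e \o cinv c) y.
  have : nbhs (c p) (c @` (dom c `&` dom d)).
    by apply: open_nbhs_nbhs; split=> //; exact: open_overlap.
  apply: filterS => y.
  by move=> /(chart_image (@subIsetl _ _ _)) [[_ dy] _ _] /=; rewrite cmapK.
have E1 := diff_compE v cpE d1 d2.
have E2 := near_eq_diff v d3 dE.
exact: (etrans (esym E1) E2).
Qed.

Lemma transition_id c p v : dom c p -> transition c c p v = v.
Proof.
move=> cp; rewrite /transition.
have did : differentiable (id : 'rV[R]_n -> 'rV[R]_n) (c p) by exact: ex_diff.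
have oc : (c @` dom c) (c p) by exists p.
have dE : \forall y \near c p, id y = (c \o cinv c) y.
  have : nbhs (c p) (c @` dom c).
    by apply: open_nbhs_nbhs; split=> //; exact: cod_open.
  apply: filterS => y.
  by move=> /(chart_image (fun _ => id)) [_ _ /= ->].
have E1 := near_eq_diff v did dE.
exact: (etrans (esym E1) (diff_idE _ v)).
Qed.

Lemma transition_componentsK c p v : atlas c -> dom c p ->
  transition c (chart_at p) p (components c p v) = v.
Proof.
move=> ac cp; have := chart_at_atlas p; have := dom_chart_at p.
by move=> ? ?; rewrite [LHS]transition_comp// transition_id.
Qed.

End Charts.

(** * Smooth functions and bump functions on a manifold *)

Section SmoothFunctions.
Context (R : realType) (n : nat) (M : manifold R n).
Implicit Types (U C : set M) (a v : M -> R).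

Definition smooth_fun_on U a :=
  forall c, atlas c -> smooth_on (c @` (U `&` dom c)) (a \o cinv c : 'rV[R]_n -> R^o).

Lemma open_image_dom (c : chart R n M) U : open U -> open (c @` (U `&` dom c)).
Proof.
move=> oU; apply: open_chart_image; last by move=> p [].
by apply: openI => //; exact: dom_open.
Qed.

Lemma smooth_fun_sub U a : smooth_fun a -> smooth_fun_on U a.
Proof.
by move=> sa c ac; apply: smooth_on_sub (sa c ac) => _ [p [_ cp] <-]; exists p.
Qed.

(** The product vanishes on the open complement of C, whatever v is there. *)
Lemma smooth_fun_extend U C a v : open U -> closed C -> C `<=` U ->
  smooth_fun a -> (forall p, ~ C p -> a p = 0) -> smooth_fun_on U v ->
  smooth_fun (fun p => a p * v p).
Proof.
move=> oU cC CU sa a0 sv c ac; apply: smooth_on_local => _ [p cp <-].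
have [Cp|nCp] := pselect (C p).
  exists (c @` (U `&` dom c)); split; first by exists p => //; split=> //; exact: CU.
  have sa' : smooth_fun_on U a by exact: smooth_fun_sub.
  exact: (smooth_onM (open_image_dom oU) (sa' c ac) (sv c ac)).
have oC : open (c @` (~` C `&` dom c)) by apply: open_image_dom; exact: closed_openC.
exists (c @` (~` C `&` dom c)); split; first by exists p.
apply: smooth_on_eq (smooth_on_cst _ (0 : R^o)) => // x [q [nCq cq] <-] /=.
by rewrite cmapK// a0// mul0r.
Qed.

Lemma smooth_funM a b : smooth_fun a -> smooth_fun b -> smooth_fun (fun p => a p * b p : R).
Proof. by move=> sa sb c ac; exact: smooth_onM (@cod_open _ _ _ c) (sa c ac) (sb c ac). Qed.

Lemma smooth_fun_cst (r : R) : smooth_fun (fun _ : M => r).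
Proof. by move=> c ac; exact: smooth_on_cst. Qed.

(** In a chart, take a bump function supported in a closed ball and extend it by
    0. The ball is compact, hence so is its image in the manifold, which is
    therefore closed by the Hausdorff property: this makes the extension smooth
    outside the chart domain. *)
Lemma bump_exists U p : open U -> U p ->
  exists a C, [/\ smooth_fun a, a p != 0, closed C, C `<=` U & forall q, ~ C q -> a q = 0].
Proof.
move=> oU Up; pose d := chart_at p.
have dp : dom d p := dom_chart_at p.
have ad : atlas d := chart_at_atlas p.
have oA := open_image_dom (c := d) oU.
have Ap : (d @` (U `&` dom d)) (d p) by exists p.
have /nbhs_closedballP [e eA] : nbhs (d p) (d @` (U `&` dom d)).
  by apply: open_nbhs_nbhs.
have [b [sb bp b0]] := bump_rV (d p) (gt0 e).
pose B := closed_ball (d p) e%:num.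
pose C := cinv d @` B.
pose a q : R := if `[< dom d q >] then b (d q) else 0.
have BE x : B x <-> `|d p - x| <= e%:num by rewrite /B closed_ballE.
have CU : C `<=` U `&` dom d.
  by move=> _ [x /eA + <-] => /(chart_image (@subIsetr _ _ _)) [].
have cB : compact B.
  apply: bounded_closed_compact; last exact: closed_ball_closed.
  exists (`|d p| + e%:num); split; first exact: num_real.
  move=> r er x /BE dx; apply: le_trans (ltW er).
  rewrite -(subrKC (d p) x) -[x - d p]opprB (le_trans (ler_normB _ _))// lerD2l.
  exact: dx.
have cC : closed C.
  apply: compact_closed; first exact: manifold_hausdorff.
  apply: continuous_compact => //.
  apply: continuous_in_subspaceT => x; rewrite inE => /eA [q [_ dq] <-].
  by apply: cinv_continuous; exists q.
have a0 q : ~ C q -> a q = 0.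
  rewrite /a; case: asboolP => // dq nC.
  apply/eqP; apply: contra_notT nC => bq; exists (d q); last exact: cmapK.
  by apply/BE; rewrite distrC; exact: b0.
exists a, C; split=> //; last by move=> q /CU [].
  move=> c ac; apply: smooth_on_local => _ [q cq <-].
  have [dq|ndq] := pselect (dom d q).
    exists (c @` (dom c `&` dom d)); split; first by exists q.
    have sbd := smooth_on_comp (open_overlap (c:=c) (d:=d)) (fun _ _ => I)
      (atlas_compatible ac ad) sb.
    apply: smooth_on_eq sbd; first exact: open_overlap.
    move=> _ [r [cr dr] <-] /=; rewrite cmapK// /a asboolT//.
  have oC : open (c @` (~` C `&` dom c)) by apply: open_image_dom; exact: closed_openC.
  exists (c @` (~` C `&` dom c)); split.
    by exists q => //; split=> // /CU [].
  apply: smooth_on_eq (smooth_on_cst _ (0 : R^o)) => // x [r [nCr cr] <-] /=.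
  by rewrite cmapK// a0.
by rewrite /a asboolT.
Qed.

End SmoothFunctions.

(** * Smooth sections along a map *)

Lemma components_is_linear (R : realType) n (M : manifold R n) (c : chart R n M)
    p : linear (components c p).
Proof. by move=> a u v; rewrite /components linearP. Qed.

HB.instance Definition _ (R : realType) n (M : manifold R n) (c : chart R n M) p :=
  GRing.isLinear.Build R _ _ _ (components c p) (components_is_linear c p).

Lemma transition_is_linear (R : realType) n (M : manifold R n)
    (c d : chart R n M) p : linear (transition c d p).
Proof. by move=> a u v; rewrite /transition linearP. Qed.

HB.instance Definition _ (R : realType) n (M : manifold R n)
    (c d : chart R n M) p :=
  GRing.isLinear.Build R _ _ _ (transition c d p) (transition_is_linear c d p).

Section Sections.
Context (R : realType) (m n : nat) (M : manifold R m) (N : manifold R n).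
Variable f : M -> N.
Hypothesis sf : smooth_map f.
Implicit Types (U C : set M) (a : M -> R) (V : M -> 'rV[R]_n).

Lemma open_image_dom2 (c : chart R m M) (d : chart R n N) U : open U ->
  open (c @` (U `&` dom c `&` f @^-1` dom d)).
Proof.
move=> oU; apply: open_chart_image; last by move=> p [[]].
apply: openI; first by apply: openI => //; exact: dom_open.
by apply: open_comp; [move=> x _; exact: sf.1|exact: dom_open].
Qed.

Lemma smooth_section_extend U C a V : open U -> closed C -> C `<=` U ->
  smooth_fun a -> (forall p, ~ C p -> a p = 0) -> smooth_section_on U f V ->
  smooth_section f (fun p => a p *: V p).
Proof.
move=> oU cC CU sa a0 sV c d ac ad; apply: smooth_on_local => _ [p [[_ cp] dp] <-].
have [Cp|nCp] := pselect (C p).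
  exists (c @` (U `&` dom c `&` f @^-1` dom d)); split.
    by exists p => //; split=> //; split=> //; exact: CU.
  have oD := open_image_dom2 (c := c) (d := d) oU.
  have sa' : smooth_on (c @` (U `&` dom c `&` f @^-1` dom d)) (a \o cinv c : _ -> R^o).
    by apply: smooth_on_sub (sa c ac) => _ [q [[_ cq] _] <-]; exists q.
  apply: smooth_on_eq (smooth_onZ oD sa' (sV c d ac ad)) => // x _ /=.
  by rewrite linearZ.
have oC : open (c @` (~` C `&` dom c `&` f @^-1` dom d)).
  by apply: open_image_dom2; exact: closed_openC.
exists (c @` (~` C `&` dom c `&` f @^-1` dom d)); split; first by exists p.
apply: smooth_on_eq (smooth_on_cst _ (0 : 'rV[R]_n)) => // x [q [[nCq cq] _] <-] /=.
by rewrite cmapK// a0// scale0r linear0.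
Qed.

Lemma smooth_sectionZ a V : smooth_fun a -> smooth_section f V ->
  smooth_section f (fun p => a p *: V p).
Proof.
move=> sa; apply: (smooth_section_extend openT closedT) => // p nT.
by case: nT.
Qed.

Lemma smooth_sectionD V V' : smooth_section f V -> smooth_section f V' ->
  smooth_section f (fun p => V p + V' p).
Proof.
move=> sV sV' c d ac ad.
have oD := open_image_dom2 (c := c) (d := d) openT.
apply: smooth_on_eq (smooth_onD oD (sV c d ac ad) (sV' c d ac ad)) => // x _ /=.
by rewrite linearD.
Qed.

Lemma smooth_section0 : smooth_section f (fun=> 0).
Proof.
move=> c d ac ad.
have oD := open_image_dom2 (c := c) (d := d) openT.
apply: smooth_on_eq (smooth_on_cst _ (0 : 'rV[R]_n)) => // x _ /=.
by rewrite linear0.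
Qed.

Lemma smooth_section_sum (I : Type) (r : seq I) (V : I -> M -> 'rV[R]_n) :
  (forall i, smooth_section f (V i)) ->
  smooth_section f (fun p => \sum_(i <- r) V i p).
Proof.
move=> sV; elim: r => [|i r IHr].
  rewrite (_ : (fun _ => _) = fun=> 0); first exact: smooth_section0.
  by apply/funext => p; rewrite big_nil.
rewrite (_ : (fun _ => _) = fun p => V i p + \sum_(i <- r) V i p).
  exact: smooth_sectionD.
by apply/funext => p; rewrite big_cons.
Qed.

(** Near p the section is the product of a V by 1/a. *)
Lemma smooth_section_div V :
  (forall p, exists a, [/\ smooth_fun a, a p != 0 & smooth_section f (fun q => a q *: V q)]) ->
  smooth_section f V.
Proof.
move=> locV c d ac ad; apply: smooth_on_local => _ [p [[_ cp] dp] <-].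
have [a [sa ap saV]] := locV p.
pose A := [set x | (c @` (setT `&` dom c `&` f @^-1` dom d)) x /\ a (cinv c x) != 0].
have oD := open_image_dom2 (c := c) (d := d) openT.
have sa' : smooth_on (c @` (setT `&` dom c `&` f @^-1` dom d)) (a \o cinv c : _ -> R^o).
  by apply: smooth_on_sub (sa c ac) => _ [q [[_ cq] _] <-]; exists q.
have oA : open A.
  rewrite openE => x [Dx ax].
  have cx := sa' 0%N x Dx.
  apply: filterI; first by apply: open_nbhs_nbhs; split.
  exact: (cx _ (open_nbhs_nbhs (conj (@open_neq _ (0 : R)) ax))).
exists A; split; first by split; [exists p|rewrite cmapK].
have AD : A `<=` c @` (setT `&` dom c `&` f @^-1` dom d) by move=> x [].
have sV := smooth_onV oA (fun x (Ax : A x) => Ax.2) (smooth_on_sub AD sa').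
apply: smooth_on_eq (smooth_onZ oA sV (smooth_on_sub AD (saV c d ac ad))) => // x [_ ax] /=.
by rewrite -linearZ scalerA mulVf// scale1r.
Qed.

Lemma smooth_fun_pull (a : N -> R) : smooth_fun a -> smooth_fun (a \o f).
Proof.
move=> sa c ac; apply: smooth_on_local => _ [p cp <-].
pose d := chart_at (f p).
exists (c @` (setT `&` dom c `&` f @^-1` dom d)); split.
  by exists p => //; split=> //; exact: dom_chart_at.
have oD := open_image_dom2 (c := c) (d := d) openT.
have sdf : smooth_on (c @` (setT `&` dom c `&` f @^-1` dom d)) (d \o f \o cinv c).
  by rewrite setTI; apply: sf.2 => //; exact: chart_at_atlas.
have ad : atlas d := chart_at_atlas (f p).
have UV x : (c @` (setT `&` dom c `&` f @^-1` dom d)) x -> (d @` dom d) ((d \o f \o cinv c) x).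
  by move=> [q [[_ cq] dq] <-] /=; rewrite cmapK//; exists (f q).
apply: smooth_on_eq (smooth_on_comp oD UV sdf (sa d ad)) => //.
by move=> _ [q [[_ cq] dq] <-] /=; rewrite !cmapK.
Qed.

Lemma smooth_section_pull (Y : N -> 'rV[R]_n) : vector_field Y -> smooth_section f (Y \o f).
Proof.
move=> sY c d ac ad.
have oD := open_image_dom2 (c := c) (d := d) openT.
have sdf : smooth_on (c @` (setT `&` dom c `&` f @^-1` dom d)) (d \o f \o cinv c).
  by rewrite setTI; apply: sf.2.
have sYd : smooth_on (d @` dom d) (fun x => components d (cinv d x) (Y (cinv d x))).
  by apply: smooth_on_sub (sY d d ad ad) => _ [q dq <-]; exists q.
have UV x : (c @` (setT `&` dom c `&` f @^-1` dom d)) x -> (d @` dom d) ((d \o f \o cinv c) x).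
  by move=> [q [[_ cq] dq] <-] /=; rewrite cmapK//; exists (f q).
apply: smooth_on_eq (smooth_on_comp_rV oD (@cod_open _ _ _ d) UV sdf sYd) => //.
by move=> _ [q [[_ cq] dq] <-] /=; rewrite !cmapK.
Qed.

Lemma smooth_section_component V (d : chart R n N) i : smooth_section f V -> atlas d ->
  smooth_fun_on (f @^-1` dom d) (fun q => components d (f q) (V q) 0 i).
Proof.
move=> sV ad c ac.
have oD := open_image_dom2 (c := c) (d := d) openT.
have := (smooth_on_rV _ oD).1 (sV c d ac ad) i.
apply: smooth_on_sub => _ [q [dq cq] <-]; by exists q.
Qed.

(** The chain rule in the preferred charts, which define dmap, and in c and d. *)
Lemma chart_dmap c d p (v : 'rV[R]_m) : atlas c -> atlas d -> dom c p -> dom d (f p) ->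
  components d (f p) (dmap f p v) = 'd (d \o f \o cinv c) (c p) (components c p v).
Proof.
move=> ac ad cp dp; pose b := chart_at p; pose e := chart_at (f p).
have [ab bp] : atlas b /\ dom b p by split; [exact: chart_at_atlas|exact: dom_chart_at].
have [ae ep] : atlas e /\ dom e (f p) by split; [exact: chart_at_atlas|exact: dom_chart_at].
have dff c1 e1 : atlas c1 -> atlas e1 -> dom c1 p -> dom e1 (f p) ->
    differentiable (e1 \o f \o cinv c1) (c1 p).
  move=> ac1 ae1 c1p e1p; apply: smooth_on_differentiable (sf.2 c1 e1 ac1 ae1) _.
  by exists p.
have nearb (A : set M) : open A -> A p -> \forall y \near b p, A (cinv b y) /\ dom b (cinv b y).
  move=> oA Ap; have : nbhs (b p) (b @` (A `&` dom b)).
    by apply: open_nbhs_nbhs; split; [exact: open_image_dom|exists p].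
  by apply: filterS => y /(chart_image (@subIsetr _ _ _)) [[]].
have bE1 : (e \o f \o cinv b) (b p) = e (f p) by rewrite /= cmapK.
have bE2 : (c \o cinv b) (b p) = c p by rewrite /= cmapK.
have dF1 := dff b e ab ae bp ep.
have dG1 := transition_differentiable ae ad ep dp.
have dF2 := transition_differentiable ab ac bp cp.
have dG2 := dff c d ac ad cp dp.
have nE1 : \forall y \near b p, (d \o f \o cinv b) y = ((d \o cinv e) \o (e \o f \o cinv b)) y.
  have : open (f @^-1` dom e).
    by apply: open_comp; [move=> x _; exact: sf.1|exact: dom_open].
  by move=> /nearb /(_ ep); apply: filterS => y [ey _] /=; rewrite cmapK.
have nE2 : \forall y \near b p, (d \o f \o cinv b) y =
    ((d \o f \o cinv c) \o (c \o cinv b)) y.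
  by have := nearb _ (@dom_open _ _ _ c) cp; apply: filterS => y [cy _] /=; rewrite cmapK.
have dH := dff b d ab ad bp dp.
have E1 := etrans (near_eq_diff v dH nE1) (diff_compE v bE1 dF1 dG1).
have E2 := etrans (near_eq_diff v dH nE2) (diff_compE v bE2 dF2 dG2).
rewrite /dmap lfunE.
exact: (etrans (esym E1) E2).
Qed.

(** In coordinates df(X) is the combination sum_i X_i D_(e_i) F of derivatives
    of the local expression F of f. *)
Lemma smooth_section_dmap X : vector_field X -> smooth_section f (fun p => dmap f p (X p)).
Proof.
move=> sX c d ac ad.
have oD := open_image_dom2 (c := c) (d := d) openT.
have sdf : smooth_on (c @` (setT `&` dom c `&` f @^-1` dom d)) (d \o f \o cinv c).
  by rewrite setTI; apply: sf.2.
have sXc : smooth_on (c @` (setT `&` dom c `&` f @^-1` dom d))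
    (fun x => components c (cinv c x) (X (cinv c x))).
  by apply: smooth_on_sub (sX c c ac ac) => _ [q [[_ cq] _] <-]; exists q.
have sXi i := (smooth_on_rV _ oD).1 sXc i.
have sum := smooth_on_sum (index_enum _) oD
  (fun i => smooth_onZ oD (sXi i) (smooth_on_derive 'e_i sdf)).
apply: smooth_on_eq sum => // x Dx /=.
have [q [[_ cq] dq] qx] := Dx; rewrite -qx cmapK// (chart_dmap _ ac)//.
rewrite [in RHS](row_sum_delta (components c q (X q))) linear_sum.
apply: eq_bigr => i _; rewrite linearZ /= deriveE//.
by apply: smooth_on_differentiable sdf _; rewrite qx.
Qed.

End Sections.

(** * Local frames and tensoriality *)

Lemma smooth_map_id (R : realType) n (N : manifold R n) : smooth_map (idfun : N -> N).
Proof.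
split; first by move=> x; exact: cvg_id.
by move=> c d ac ad; exact: atlas_compatible.
Qed.

Lemma transitionZ (R : realType) n (N : manifold R n) (c d : chart R n N) p a v :
  transition c d p (a *: v) = a *: transition c d p v.
Proof. by rewrite /transition linearZ. Qed.

Section Frames.
Context (R : realType) (n : nat) (N : manifold R n).

(** The field with constant components w in the chart d. *)
Definition coordinate_field (d : chart R n N) (w : 'rV[R]_n) (q : N) : 'rV[R]_n :=
  transition d (chart_at q) q w.

(** Its components in a chart e are the derivatives D_w of the change of
    coordinates from d to e. *)
Lemma smooth_coordinate_field (d : chart R n N) w : atlas d ->
  smooth_section_on (dom d) (idfun : N -> N) (coordinate_field d w).
Proof.
move=> ad c e ac ae.
pose A := c @` (dom d `&` dom c `&` idfun @^-1` dom e).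
have oA : open A.
  exact: (open_image_dom2 (smooth_map_id N) (c := c) (d := e) (@dom_open _ _ _ d)).
have sdc : smooth_on A (d \o cinv c).
  by apply: smooth_on_sub (atlas_compatible ac ad) => _ [q [[dq cq] eq] <-]; exists q.
have UV x : A x -> (d @` (dom d `&` dom e)) ((d \o cinv c) x).
  by move=> [q [[dq cq] eq] <-] /=; rewrite cmapK//; exists q.
have sD := smooth_on_derive w (atlas_compatible ad ae).
apply: smooth_on_eq (smooth_on_comp_rV oA (open_overlap (c := d) (d := e)) UV sdc sD) => //.
move=> x [q [[dq cq] /= eq] <-] /=; rewrite cmapK// /coordinate_field.
rewrite [RHS](transition_comp w ad (chart_at_atlas q) ae dq (dom_chart_at q) eq).
by rewrite deriveE//; exact: transition_differentiable.
Qed.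

(** A bump function a supported in a chart at y0 makes both the coordinate
    fields and the components of V along f globally defined, once multiplied by
    it; hence the two factors a. *)
Lemma local_frame (y0 : N) : exists (a : N -> R) (E : 'I_n -> N -> 'rV[R]_n),
  [/\ smooth_fun a, a y0 != 0, forall i, vector_field (E i)
    & forall m (M : manifold R m) (f : M -> N) V, smooth_map f -> smooth_section f V ->
      exists v : 'I_n -> M -> R, (forall i, smooth_fun (v i)) /\
        forall p, a (f p) *: (a (f p) *: V p) = \sum_i v i p *: E i (f p)].
Proof.
pose d := chart_at y0; have ad : atlas d := chart_at_atlas y0.
have [a [C [sa ay cC CU a0]]] := bump_exists (@dom_open _ _ _ d) (dom_chart_at y0).
exists a, (fun i q => a q *: coordinate_field d 'e_i q); split=> //.
  move=> i; apply: (smooth_section_extend (smooth_map_id N) (@dom_open _ _ _ d) cC) => //.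
  exact: smooth_coordinate_field.
move=> m M f V sf sV.
exists (fun i p => a (f p) * components d (f p) (V p) 0 i); split=> [i|p].
  have oU : open (f @^-1` dom d).
    by apply: open_comp; [move=> x _; exact: sf.1|exact: dom_open].
  have cC' : closed (f @^-1` C) by apply: closed_comp => // x _; exact: sf.1.
  apply: (smooth_fun_extend oU cC') (smooth_fun_pull sf sa) _ _ => [q /CU //|q Cq|].
    exact: a0.
  exact: smooth_section_component.
have [dp|ndp] := pselect (dom d (f p)); last first.
  have ap : a (f p) = 0 by apply: a0 => /CU.
  by rewrite ap !scale0r big1// => i _; rewrite mul0r scale0r.
rewrite -[V p in LHS](transition_componentsK (V p) ad dp).
rewrite [components d (f p) (V p) in LHS]row_sum_delta linear_sum /= !scaler_sumr.
by apply: eq_bigr => i _; rewrite transitionZ /= !scalerA; congr (_ *: _); ring.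
Qed.

End Frames.

(** Being proportional to V, the global section stays in any family of subspaces
    that contains V. *)
Lemma section_localize (R : realType) m n (M : manifold R m) (N : manifold R n)
    (f : M -> N) (U : set M) V p : smooth_map f -> open U -> U p ->
  smooth_section_on U f V ->
  exists b : M -> R, [/\ b p = 1, forall q, ~ U q -> b q = 0
    & smooth_section f (fun q => b q *: V q)].
Proof.
move=> sf oU Up sV; have [a [C [sa ap cC CU a0]]] := bump_exists oU Up.
exists (fun q => (a p)^-1 * a q); split.
- by rewrite mulVf.
- by move=> q nUq; rewrite (a0 q) ?mulr0// => /CU.
- apply: (smooth_section_extend sf oU cC CU) => //.
    apply: smooth_funM => //; exact: smooth_fun_cst.
  by move=> q nCq; rewrite (a0 q) ?mulr0.
Qed.

Lemma vector_field_through (R : realType) n (N : manifold R n) (y : N) w :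
  exists2 X : N -> 'rV[R]_n, vector_field X & X y = w.
Proof.
pose d := chart_at y; have ad : atlas d := chart_at_atlas y.
have dy : dom d y := dom_chart_at y.
have sV := smooth_coordinate_field (components d y w) ad.
have [b [b1 _ sX]] := section_localize (smooth_map_id N) (@dom_open _ _ _ d) dy sV.
eexists; first exact: sX.
by rewrite /= b1 scale1r [LHS]transition_componentsK.
Qed.

Section Tensoriality.
Context (R : realType) (m n l : nat) (M : manifold R m) (N : manifold R n).
Variables (f : M -> N) (p : M).
Hypothesis sf : smooth_map f.

(** With a and E as in local_frame at f p, a^2 V is a combination of fields E_i
    along f, so that a(f p)^2 T(V) = 0, while a(f p) is not zero. *)
Lemma tensorial_eq0 (T : (M -> 'rV[R]_n) -> 'rV[R]_l) :
  (forall V V', smooth_section f V -> smooth_section f V' ->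
     T (fun q => V q + V' q) = T V + T V') ->
  (forall a V, smooth_fun a -> smooth_section f V ->
     T (fun q => a q *: V q) = a p *: T V) ->
  (forall Y, vector_field Y -> T (Y \o f) = 0) ->
  forall V, smooth_section f V -> T V = 0.
Proof.
move=> TD TZ T0 V sV.
have [a [E [sa ap sE]]] := local_frame (f p).
move=> /(_ _ _ _ _ sf sV) [v [sv VE]].
have saf := smooth_fun_pull sf sa.
have sEf i : smooth_section f (E i \o f) by exact: smooth_section_pull.
have T00 : T (fun=> 0) = 0.
  have := TZ (fun=> 0) _ (@smooth_fun_cst R m M 0) (smooth_section0 sf).
  rewrite (scale0r (T _)) => <-; congr T.
  by apply/funext => q; rewrite scaler0.
have Tsum (s : seq 'I_n) : T (fun q => \sum_(i <- s) v i q *: E i (f q)) = 0.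
  elim: s => [|i s IHs].
    by rewrite -[RHS]T00; congr T; apply/funext => q; rewrite big_nil.
  rewrite (_ : (fun _ => _) = fun q => v i q *: E i (f q) +
      \sum_(j <- s) v j q *: E j (f q)); last by apply/funext => q; rewrite big_cons.
  rewrite TD ?IHs; last 2 first.
  - exact: (smooth_sectionZ sf (sv i) (sEf i)).
  - by apply: (smooth_section_sum sf) => j; exact: (smooth_sectionZ sf (sv j) (sEf j)).
  by rewrite (TZ (v i) (E i \o f))// T0// scaler0 addr0.
have := Tsum (index_enum _).
rewrite (_ : (fun _ => _) = fun q => a (f q) *: (a (f q) *: V q)).
  rewrite TZ //; last exact: (smooth_sectionZ sf saf sV).
  rewrite (TZ (a \o f)) // scalerA => /eqP; rewrite scaler_eq0 mulf_eq0 orbb /=.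
  by rewrite (negPf ap) => /eqP.
by apply/funext => q; rewrite VE.
Qed.

End Tensoriality.

(** The Leibniz terms of the two connections are equal, so their mean is the
    same term. *)
Lemma mean_connection_along (R : realType) m n (M : manifold R m) (N : manifold R n)
    (f : M -> N) D Ds : smooth_map f ->
  connection_along f D -> connection_along f Ds ->
  connection_along f (mean_connection D Ds).
Proof.
move=> sf [D1 D2 D3 D4] [E1 E2 E3 E4]; rewrite /mean_connection; split.
- move=> X V sX sV; apply: (smooth_sectionZ sf (@smooth_fun_cst R m M 2^-1)).
  by apply: (smooth_sectionD sf); [exact: D1|exact: E1].
- move=> a X X' V sa sX sX' sV p; rewrite D2// E2//.
  by rewrite addrACA -(scalerDr (a p)) [LHS]scalerDr !scalerA (mulrC (a p)).
- move=> X V V' sX sV sV' p; rewrite D3// E3//.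
  by rewrite addrACA scalerDr.
- move=> a X V sa sX sV p; rewrite D4// E4//.
  rewrite addrACA -(scalerDr (a p)) [LHS]scalerDr.
  congr (_ + _); last by rewrite !scalerA mulrC.
  by rewrite -scalerDl scalerA; congr (_ *: _); field.
Qed.

(** * Linear algebra of the lightlike decomposition *)

Section LightlikeAlgebra.
Context (R : realType) (n : nat) (G : 'M[R]_n).
Hypothesis Gsym : G^T = G.
Implicit Types (u v w : 'rV[R]_n) (U V : {vspace 'rV[R]_n}).

Lemma bformDl u u' v : bform G (u + u') v = bform G u v + bform G u' v.
Proof. by rewrite /bform !mulmxDl mxE. Qed.

Lemma bformZl a u v : bform G (a *: u) v = a * bform G u v.
Proof. by rewrite /bform -!scalemxAl mxE. Qed.

Lemma bformC u v : bform G u v = bform G v u.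
Proof.
rewrite /bform -[in LHS](trmxK (u *m G *m v^T)) mxE !trmx_mul Gsym trmxK.
by rewrite mulmxA.
Qed.

Lemma bformDr u v v' : bform G u (v + v') = bform G u v + bform G u v'.
Proof. by rewrite bformC bformDl !(bformC _ u). Qed.

Lemma bformZr a u v : bform G u (a *: v) = a * bform G u v.
Proof. by rewrite bformC bformZl bformC. Qed.

Lemma bform_sumr (I : Type) (r : seq I) u (F : I -> 'rV[R]_n) :
  bform G u (\sum_(i <- r) F i) = \sum_(i <- r) bform G u (F i).
Proof.
elim: r => [|i r IHr]; last by rewrite !big_cons bformDr IHr.
by rewrite !big_nil /bform trmx0 mulmx0 mxE.
Qed.

(** The orthogonal is an intersection of dim U kernels of linear forms. *)
Lemma dim_orthv U : (n <= \dim U + \dim (orthv G U))%N.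
Proof.
rewrite /orthv -[X in (_ <= X + _)%N](size_tuple (vbasis U)).
elim: (tval (vbasis U)) => [|u s IHs].
  by rewrite big_nil dimvf /dim /= mul1n.
rewrite big_cons capvC.
set K := (\bigcap_(_ <- s) _)%VS in IHs *.
have /esym := limg_ker_dim (linfun (mulmxr (G *m u^T) : 'rV[R]_n -> 'rV[R]_1)) K.
set f := linfun _ => dimK.
have : (\dim (f @: K) <= 1)%N.
  by apply: leq_trans (dimvS (subvf _)) _; rewrite dimvf /dim /=.
move: IHs; rewrite dimK /= => h1 h2; apply: leq_trans h1 _.
by rewrite addSnnS leq_add2l -[leqRHS]addn1 leq_add2l.
Qed.

(** The notation corresponds to a point of a lightlike submanifold as follows:
    T is TM, P is TM^perp, Rd is Rad(TM), S and Q are the screens S(TM) and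
    S(TM^perp), and L is ltr(TM), with the dual frames xi of Rd and lb of L. *)
Variables (T S Q L : {vspace 'rV[R]_n}).
Let P := orthv G T.
Let Rd := (T :&: P)%VS.
Hypotheses (RdS : (Rd + S)%VS = T) (capRdS : (Rd :&: S)%VS = 0%VS).
Hypotheses (RdQ : (Rd + Q)%VS = P) (capRdQ : (Rd :&: Q)%VS = 0%VS).
Variables (r : nat) (xi lb : 'I_r -> 'rV[R]_n).
Hypotheses (bxi : basis_of Rd [tuple xi i | i < r]) (sL : L = <<[tuple lb i | i < r]>>%VS).
Hypothesis lb_orth : forall i, lb i \in (orthv G S :&: orthv G Q)%VS.
Hypothesis dual : forall i j, bform G (xi i) (lb j) = (i == j)%:R.

Lemma TP_orth t w : t \in T -> w \in P -> bform G t w = 0.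
Proof. by move=> tT /orthvP wP; rewrite bformC wP. Qed.

Lemma QsubP : (Q <= P)%VS. Proof. by rewrite -RdQ addvSr. Qed.
Lemma SsubT : (S <= T)%VS. Proof. by rewrite -RdS addvSr. Qed.

Lemma TQ_orth t w : t \in T -> w \in Q -> bform G t w = 0.
Proof. by move=> tT /(subvP QsubP); exact: TP_orth. Qed.

Lemma LE w : w \in L -> exists c : 'I_r -> R, w = \sum_i c i *: lb i.
Proof.
rewrite sL => /coord_span ->; eexists; apply: eq_bigr => i _.
by rewrite nth_mktuple.
Qed.

Lemma LS_orth w s : w \in L -> s \in S -> bform G w s = 0.
Proof.
move=> /LE [c ->] sS; rewrite bformC bform_sumr big1// => i _.
have := lb_orth i; rewrite memv_cap => /andP[/orthvP h _].
by rewrite bformZr bformC h// mulr0.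
Qed.

Lemma LQ_orth w s : w \in L -> s \in Q -> bform G w s = 0.
Proof.
move=> /LE [c ->] sS; rewrite bformC bform_sumr big1// => i _.
have := lb_orth i; rewrite memv_cap => /andP[_ /orthvP h].
by rewrite bformZr bformC h// mulr0.
Qed.

Lemma xiRd i : xi i \in Rd.
Proof. by apply: (basis_mem bxi); apply/mapP; exists i; rewrite ?mem_enum. Qed.

(** Pairing with xi_i gives the i-th coefficient on the dual frame. *)
Lemma L_ker w : w \in L -> (forall x, x \in Rd -> bform G x w = 0) -> w = 0.
Proof.
move=> /LE [c ->] h; rewrite big1// => i _.
have := h _ (xiRd i); rewrite bform_sumr (bigD1 i)//= big1 => [|j ji].
  by rewrite bformZr dual eqxx mulr1 addr0 => ->; rewrite scale0r.
by rewrite bformZr dual eq_sym (negPf ji) mulr0.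
Qed.

(** Pairing with Rd kills T and Q, so the L component vanishes by duality; the
    others are then opposite and lie in the intersection of Rd and Q. *)
Lemma sum3_eq0 t w q : t \in T -> w \in L -> q \in Q -> t + (w + q) = 0 ->
  [/\ t = 0, w = 0 & q = 0].
Proof.
move=> tT wL qQ e0.
have w0 : w = 0.
  apply: L_ker => // x; rewrite memv_cap => /andP[xT xP].
  have : bform G x (t + (w + q)) = 0 by rewrite e0 /bform trmx0 mulmx0 mxE.
  by rewrite !bformDr (bformC x t) (TP_orth tT xP) (TQ_orth xT qQ) addr0 add0r.
move: e0; rewrite w0 add0r => /eqP; rewrite addr_eq0 => /eqP tq.
have : q \in (Rd :&: Q)%VS.
  rewrite !memv_cap qQ andbT; apply/andP; split; last exact: (subvP QsubP).
  by rewrite -[q]opprK -tq memvN.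
by rewrite capRdQ memv0 => /eqP q0; rewrite tq q0 oppr0.
Qed.

Lemma cap_TLQ : (T :&: (L + Q))%VS = 0%VS.
Proof.
apply/eqP; rewrite -subv0; apply/subvP => t; rewrite memv_cap => /andP[tT].
move=> /memv_addP [w wL [q qQ tE]].
have [] := @sum3_eq0 (- t) w q; rewrite ?memvN//; first by rewrite tE addNr.
by move=> /eqP; rewrite oppr_eq0 memv0.
Qed.

Lemma cap_QTL : (Q :&: (T + L))%VS = 0%VS.
Proof.
apply/eqP; rewrite -subv0; apply/subvP => q; rewrite memv_cap => /andP[qQ].
move=> /memv_addP [t tT [w wL qE]].
have [] := @sum3_eq0 t w (- q); rewrite ?memvN//; first by rewrite qE addrA subrr.
by move=> _ _ /eqP; rewrite oppr_eq0 memv0.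
Qed.

Lemma dim_L : \dim L = r.
Proof.
rewrite sL; apply/eqP; rewrite -[X in _ == X](size_tuple [tuple lb i | i < r]).
apply/freeP => k e0 i.
have := congr1 (bform G (xi i)) e0; rewrite bform_sumr (bigD1 i)//= big1 => [|j ji].
  by rewrite nth_mktuple bformZr dual eqxx mulr1 addr0 => ->; rewrite /bform trmx0 mulmx0 mxE.
by rewrite nth_mktuple bformZr dual eq_sym (negPf ji) mulr0.
Qed.

(** Dimension count: L has the dimension of Rd, so L + Q has that of P, and
    dim_orthv applies. *)
Lemma sum_TLQ : (T + (L + Q))%VS = fullv.
Proof.
apply/eqP; rewrite -dimv_leqif_eq ?subvf//; apply/eqP/anti_leq; rewrite dimvS ?subvf//=.
have dRd : \dim Rd = r by rewrite -(size_basis bxi).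
have dP : \dim P = (r + \dim Q)%N by rewrite -RdQ (dimv_disjoint_sum capRdQ) dRd.
have := dim_orthv T; rewrite -/P dP.
have cLQ : (L :&: Q)%VS = 0%VS.
  apply/eqP; rewrite -subv0 -cap_QTL capvC; apply: capvS => //; exact: addvSr.
rewrite (dimv_disjoint_sum cap_TLQ) (dimv_disjoint_sum cLQ) dim_L.
by rewrite dimvf /dim /= mul1n.
Qed.

(** The other two components of w are orthogonal to S. *)
Lemma tangent_part_bform w z : z \in S ->
  bform G (daddv_pi T (L + Q) w) z = bform G w z.
Proof.
move=> zS; have wE : daddv_pi T (L + Q) w + daddv_pi (L + Q) T w = w.
  by apply: daddv_pi_add; [exact: cap_TLQ|rewrite sum_TLQ memvf].
rewrite -[in RHS]wE bformDl; set x := daddv_pi (L + Q) T w.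
have /memv_addP [l lL [q qQ ->]] : x \in (L + Q)%VS by exact: memv_pi.
rewrite bformDl (LS_orth lL zS) (bformC q z) (TQ_orth _ qQ) ?addr0//.
exact: (subvP SsubT).
Qed.

(** The other two components of w are orthogonal to Q. *)
Lemma screen_transversal_part_bform w z : z \in Q ->
  bform G (daddv_pi Q (T + L) w) z = bform G w z.
Proof.
move=> zQ; have wE : daddv_pi Q (T + L) w + daddv_pi (T + L) Q w = w.
  apply: daddv_pi_add; first exact: cap_QTL.
  by rewrite addvC -addvA sum_TLQ memvf.
rewrite -[in RHS]wE bformDl; set x := daddv_pi (T + L) Q w.
have /memv_addP [t tT [l lL ->]] : x \in (T + L)%VS by exact: memv_pi.
by rewrite bformDl (LQ_orth lL zQ) (TQ_orth tT zQ) !addr0.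
Qed.

End LightlikeAlgebra.

(** * The Kenmotsu identity along a map *)

Section Kenmotsu.
Context (R : realType) (n m : nat) (N : manifold R (2 * n).+1)
  (K : kenmotsu_statistical N) (M : manifold R m) (f : M -> N).
Hypothesis sf : smooth_map f.

(** The tensor phi is known to preserve smoothness of ambient fields only; a
    local frame of such fields reduces the case of sections along f to it. *)
Lemma smooth_section_phi V : smooth_section f V ->
  smooth_section f (fun q => phi K (f q) (V q)).
Proof.
move=> sV; apply: (smooth_section_div sf) => p.
have [a [E [sa ap sE]]] := local_frame (f p).
move=> /(_ _ _ _ _ sf sV) [v [sv VE]].
have saf := smooth_fun_pull sf sa.
exists (fun q => a (f q) * a (f q)); split; first exact: smooth_funM.
  by rewrite mulf_neq0.
rewrite (_ : (fun _ => _) = fun q => \sum_i v i q *: phi K (f q) (E i (f q))).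
  apply: (smooth_section_sum sf) => i; apply: (smooth_sectionZ sf) => //.
  exact: smooth_section_pull sf _ (phi_smooth K (sE i)).
apply/funext => q; have := congr1 (phi K (f q)) (VE q).
rewrite !linearZ /= scalerA => ->; rewrite linear_sum.
by apply: eq_bigr => i _; rewrite linearZ.
Qed.

Variables (D Ds : (M -> 'rV[R]_m) -> (M -> 'rV[R]_(2 * n).+1) -> M -> 'rV[R]_(2 * n).+1).
Hypotheses (HD : pullback_connection f (nab K) D)
  (HDs : pullback_connection f (nabs K) Ds).

(** The difference T of both sides is tensorial in V, because the derivatives of
    coefficients cancel between nabla_X (phi V) and phi (nabla_X V). On the
    restriction of an ambient field it vanishes by the Kenmotsu identity, applied
    to an ambient field X' with value df(X) at f p. *)
Lemma kenmotsu_phi_along X V p : vector_field X -> smooth_section f V ->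
  mean_connection D Ds X (fun q => phi K (f q) (V q)) p
  = phi K (f p) (mean_connection D Ds X V p)
    + ((eta K (f p) (V p) : R) *: phi K (f p) (dmap f p (X p))
       - bform (gbar K (f p)) (phi K (f p) (dmap f p (X p))) (V p) *: nu K (f p)).
Proof.
move=> sX sV; have [cD pD] := HD; have [cDs pDs] := HDs.
have [_ _ hD hZ] := mean_connection_along sf cD cDs.
pose x := dmap f p (X p); pose g := gbar K (f p).
pose T V := mean_connection D Ds X (fun q => phi K (f q) (V q)) p
  - phi K (f p) (mean_connection D Ds X V p)
  - ((eta K (f p) (V p) : R) *: phi K (f p) x - bform g (phi K (f p) x) (V p) *: nu K (f p)).
have gsym : g^T = g by have [gs _ _ _] := gbar_semi_riemannian K; exact: gs.
suff T0 : T V = 0.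
  move/eqP: T0; rewrite /T subr_eq0 subr_eq => /eqP ->; exact: addrC.
apply: (tensorial_eq0 (p := p) sf) sV => {V}.
- move=> V V' sV sV'; rewrite /T.
  have -> : (fun q => phi K (f q) (V q + V' q)) =
      (fun q => phi K (f q) (V q) + phi K (f q) (V' q)).
    by apply/funext => q; rewrite linearD.
  rewrite !hD//; [|exact: smooth_section_phi..].
  rewrite !linearD /= (bformDr gsym).
  by apply/rowP => i; rewrite !mxE /=; ring.
- move=> a V sa sV; rewrite /T.
  have -> : (fun q => phi K (f q) (a q *: V q)) = (fun q => a q *: phi K (f q) (V q)).
    by apply/funext => q; rewrite linearZ.
  rewrite !hZ//; last exact: smooth_section_phi.
  rewrite linearD !linearZ /= (bformZr gsym).
  by apply/rowP => i; rewrite !mxE /GRing.scale /=; ring.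
- move=> Y sY; rewrite /T.
  have [X' sX' X'p] := vector_field_through (f p) x.
  have sphiY := phi_smooth K sY.
  have H1 : mean_connection D Ds X (Y \o f) p = mean_connection (nab K) (nabs K) X' Y (f p).
    by rewrite /mean_connection (pD X X')// (pDs X X').
  have H2 : mean_connection D Ds X ((fun q => phi K q (Y q)) \o f) p
      = mean_connection (nab K) (nabs K) X' (fun q => phi K q (Y q)) (f p).
    by rewrite /mean_connection (pD X X')// (pDs X X').
  have := kenmotsu_phi K sX' sY (f p); rewrite -H1 -H2 X'p => h.
  by apply: (etrans (congr1 (fun w => w - _) h)); rewrite subrr.
Qed.

End Kenmotsu.

(** Extend z with constant coefficients on a local frame of E, then cut off each
    frame field. *)
Lemma distribution_section (R : realType) m n (M : manifold R m) (N : manifold R n)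
    (f : M -> N) k E p z : distribution f k E -> z \in E p ->
  exists2 Z, section_of f E Z & dmap f p (Z p) = z.
Proof.
move=> /(_ p) [U [s [oU Up ss bE]]] zE.
have /choice [b bP] i := section_localize (smooth_map_id M) oU Up (ss i).
have bas := bE p Up.
pose c i := coord [tuple dmap f p (s i p) | i < k] i z.
have zc : z = \sum_i c i *: dmap f p (s i p).
  have := coord_basis bas zE => {1}->; apply: eq_bigr => i _.
  by rewrite nth_mktuple.
exists (fun q => \sum_i c i *: (b i q *: s i q)).
  split=> [|q].
    apply: (smooth_section_sum (smooth_map_id M)) => i.
    apply: (smooth_sectionZ (smooth_map_id M)); first exact: smooth_fun_cst.
    by have [] := bP i.
  rewrite linear_sum memv_suml// => i _; rewrite !linearZ /=.
  have [Uq|nUq] := pselect (U q).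
    by rewrite !memvZ//; apply: (basis_mem (bE q Uq)); apply/mapP; exists i; rewrite ?mem_enum.
  by have [_ -> //] := bP i; rewrite scale0r scaler0 mem0v.
rewrite linear_sum zc; apply: eq_bigr => i _.
by have [b1 _ _] := bP i; rewrite b1 scale1r linearZ.
Qed.

(** * Contact SCR-lightlike submanifolds *)

Section ContactSCR.
Context (R : realType) (n m : nat) (N : manifold R (2 * n).+1)
  (K : kenmotsu_statistical N) (M : manifold R m) (f : M -> N)
  (S : contact_SCR K f).
Variable p : M.
Local Notation g := (bform (gbar K (f p))).
Implicit Types u v w t z : 'rV[R]_(2 * n).+1.

Lemma gbar_sym : (gbar K (f p))^T = gbar K (f p).
Proof. by have [gs _ _ _] := gbar_semi_riemannian K; exact: gs. Qed.

Lemma tangent_orth t w : t \in TM f p -> w \in TMperp (gbar K) f p -> g t w = 0.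
Proof. by move=> tT wP; exact: (TP_orth gbar_sym tT wP). Qed.

Lemma STMp_perp : (STMp S p <= TMperp (gbar K) f p)%VS.
Proof. by rewrite -(STMp_sum S p) addvSr. Qed.

Lemma STM_TM : (STM S p <= TM f p)%VS.
Proof. by rewrite -(STM_sum S p) addvSr. Qed.

Lemma STMp_part_bform w z : z \in STMp S p -> g (STMp_part S p w) z = g w z.
Proof.
have [U [xi [L [_ Up _ _ H]]]] := ltr_frame S p.
have [bxi sL Lorth dual _] := H p Up.
exact: (screen_transversal_part_bform gbar_sym (STMp_sum S p) (STMp_cap S p)
  bxi sL Lorth dual).
Qed.

Lemma TM_part_bform w z : z \in STM S p -> g (TM_part S p w) z = g w z.
Proof.
have [U [xi [L [_ Up _ _ H]]]] := ltr_frame S p.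
have [bxi sL Lorth dual _] := H p Up.
exact: (tangent_part_bform gbar_sym (STM_sum S p) (STMp_sum S p) (STMp_cap S p)
  bxi sL Lorth dual).
Qed.

Lemma Dperp_STM z : z \in Dperp S p -> z \in STM S p.
Proof. by rewrite Dperp_orthogonal memv_cap => /andP[]. Qed.

Lemma phi_Dperp_STMp z : z \in Dperp S p -> phi K (f p) z \in STMp S p.
Proof. by move=> zD; apply: (subvP (phi_Dperp S p)); exact: memv_img. Qed.

Lemma Dperp_DinvE z u : z \in Dperp S p -> u \in (Dinv S p + <[nu K (f p)]>)%VS -> g u z = 0.
Proof.
rewrite Dperp_orthogonal memv_cap => /andP[_ /orthvP h] uD.
by rewrite (bformC gbar_sym) h.
Qed.

Lemma eta_Dperp z : z \in Dperp S p -> eta K (f p) z = 0.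
Proof.
move=> zD; rewrite -eta_nu (bformC gbar_sym); apply: Dperp_DinvE zD _.
exact: (subvP (addvSr _ _) _ (memv_line _)).
Qed.

(** TM is the sum of the mutually orthogonal Dbar + nu and Dperp. If t is
    orthogonal to Dperp, its Dperp component is orthogonal to all of TM; it then
    lies in the radical as well as in the screen, hence vanishes. *)
Lemma mem_Dbar_nu t : t \in TM f p ->
  t \in Dbar_nu S p <-> (forall z, z \in Dperp S p -> g t z = 0).
Proof.
have TE : (Dbar_nu S p + Dperp S p)%VS = TM f p.
  rewrite -(STM_sum S p) STM_decomposition /Dbar_nu /Dbar.
  rewrite (addvC (Dinv S p) (Rad _ _ _)) -!addvA; congr (_ + (_ + _))%VS.
  exact: addvC.
have orth u z : u \in Dbar_nu S p -> z \in Dperp S p -> g u z = 0.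
  move=> /memv_addP [_ /memv_addP [d dD [x xR ->]] [e eN ->]] zD.
  have zT : z \in TM f p by apply: (subvP STM_TM); exact: Dperp_STM.
  rewrite !(bformDl) (bformC gbar_sym x z) (tangent_orth zT).
    rewrite addr0 -bformDl; exact: (Dperp_DinvE zD (memv_add dD eN)).
  by move: xR; rewrite memv_cap => /andP[].
move=> tT; split=> [tD z zD|h]; first exact: orth.
move: tT; rewrite -TE => /memv_addP [u uD [e eD tE]].
suff -> : t = u by [].
have eP : e \in TMperp (gbar K) f p.
  apply/orthvP => y; rewrite -TE => /memv_addP [y1 y1D [y2 y2D ->]].
  rewrite (bformDr gbar_sym) (bformC gbar_sym e y1) (orth _ _ y1D eD) add0r.
  by have := h y2 y2D; rewrite tE bformDl (orth _ _ uD y2D) add0r.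
have e0 : e \in (Rad (gbar K) f p :&: STM S p)%VS.
  rewrite !memv_cap eP (Dperp_STM eD) !andbT.
  exact: (subvP STM_TM _ (Dperp_STM eD)).
by move: e0; rewrite STM_cap memv0 tE => /eqP ->; rewrite addr0.
Qed.

End ContactSCR.

Theorem theorem5p6 (R : realType) (n m : nat)
    (Mb : manifold R (2 * n).+1) (K : kenmotsu_statistical Mb)
    (M : manifold R m) (f : M -> Mb) (S : contact_SCR K f)
    (D Ds : (M -> 'rV[R]_m) -> (M -> 'rV[R]_(2 * n).+1) ->
            M -> 'rV[R]_(2 * n).+1)
    (HD : pullback_connection f (nab K) D)
    (HDs : pullback_connection f (nabs K) Ds) :
  totally_geodesic_foliation S D Ds (Dbar_nu S)
  <->
  (forall X Y Z : M -> 'rV[R]_m,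
     section_of f (Dbar_nu S) X -> section_of f (Dbar_nu S) Y ->
     section_of f (Dperp S) Z ->
     let phiY := fun q => phi K (f q) (dmap f q (Y q)) in
     forall p : M,
       bform (gbar K (f p)) (hs S Ds X phiY p + hs S D X phiY p)
             (phi K (f p) (dmap f p (Z p))) = 0).
Proof.
have [sf _ _] := lightlike_submfd S.
have tT p w : TM_part S p w \in TM f p by exact: memv_pi.
(* The factor 2 comes from the mean connection being half of the sum. *)
have key X Y p z : section_of f (Dbar_nu S) X -> section_of f (Dbar_nu S) Y ->
    z \in Dperp S p ->
    bform (gbar K (f p))
      (hs S Ds X (fun q => phi K (f q) (dmap f q (Y q))) p
       + hs S D X (fun q => phi K (f q) (dmap f q (Y q))) p) (phi K (f p) z)
    = 2 * bform (gbar K (f p))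
        (TM_part S p (mean_connection D Ds X (fun q => dmap f q (Y q)) p)) z.
  move=> [sX DX] [sY DY] zD.
  have gs := gbar_sym K f p.
  have pzS := phi_Dperp_STMp zD.
  have nuT : nu K (f p) \in TM f p := nu_tangent S p.
  have etaz := eta_Dperp zD.
  have xT : dmap f p (X p) \in TM f p by rewrite /TM memv_img ?memvf.
  have gxz := (mem_Dbar_nu S xT).1 (DX p) z zD.
  have gnu : bform (gbar K (f p)) (nu K (f p)) (phi K (f p) z) = 0.
    by apply: tangent_orth nuT _; exact: (subvP (STMp_perp S p)).
  rewrite bformDl /hs (STMp_part_bform _ pzS) (STMp_part_bform _ pzS).
  rewrite (TM_part_bform _ (Dperp_STM zD)).
  have := kenmotsu_phi_along sf HD HDs p sX (smooth_section_dmap sf sY).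
  move=> WE; set V := fun q => phi K (f q) (dmap f q (Y q)) in WE *.
  have -> : bform (gbar K (f p)) (Ds X V p) (phi K (f p) z) +
      bform (gbar K (f p)) (D X V p) (phi K (f p) z) =
      2 * bform (gbar K (f p)) (mean_connection D Ds X V p) (phi K (f p) z).
    rewrite /mean_connection bformZl mulrA divff ?pnatr_eq0// mul1r bformDl.
    exact: addrC.
  have iso w : bform (gbar K (f p)) (phi K (f p) w) (phi K (f p) z) =
      bform (gbar K (f p)) w z.
    by rewrite phi_isometry etaz mulr0 subr0.
  congr (2 * _); rewrite WE bformDl iso.
  have -> : bform (gbar K (f p))
      ((eta K (f p) (dmap f p (Y p)) : R) *: phi K (f p) (dmap f p (X p))
       - bform (gbar K (f p)) (phi K (f p) (dmap f p (X p))) (dmap f p (Y p))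
         *: nu K (f p)) (phi K (f p) z) = 0.
    by rewrite bformDl bformZl iso gxz mulr0 add0r -scaleNr bformZl gnu mulr0.
  exact: addr0.
split=> [tgf X Y Z sX sY sZ /= p|H X Y sX sY p].
  by rewrite key ?((mem_Dbar_nu S (tT p _)).1 (tgf X Y sX sY p))// ?mulr0//; have [] := sZ.
apply/(mem_Dbar_nu S (tT p _)) => z zD.
have [k _ dD] := Dperp_distribution S.
have [Z sZ Zp] := distribution_section dD zD.
subst z; have := etrans (esym (key X Y p _ sX sY zD)) (H X Y Z sX sY sZ p).
by move/eqP; rewrite mulf_eq0 pnatr_eq0/= => /eqP.
Qed.
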